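(* Let $g>1$, and let $Z_g$ be the staircase of genus $g$ equipped with its multi-twist action of $\mathbb{F}_2=\langle a_2,b_2\rangle$. Let $(\Gamma_n)_n$ be an expander that is (uniformly) quasi-isometric to the warped cone $\mathcal{O}_{\mathbb{F}_2}Z_g$ over this action. Then the discrete fundamental groups $\pi_{1,r}(\Gamma_n)$ at scale $r$ vanish for all sufficiently large $r$ and $n$. Consequently: (i) the expander $(\Gamma_n)_n$ is not coarsely equivalent to any box space; (ii) the expander $(\Gamma_n)_n$ is not coarsely equivalent to any warped cone $\mathcal{O}_HY$, where $H$ is an infinite group, $Y$ is a manifold, and the action $H\curvearrowright Y$ is free.
   Context: Staircase. For a positive integer $g$, put $m=2g-1$ and let $\sigma=(1\ 2)(3\ 4)\cdots(2g-3\ \ 2g-2)$, $\tau=(2\ 3)(4\ 5)\cdots(2g-2\ \ 2g-1)$ be permutations of $\{1,\dots,m\}$. $Z_g$ is the closed surface (of genus $g$) obtained from copies $P_1,\dots,P_m$ of $[0,1]^2$, with identifying homeomorphisms $\rho_i\colon P_i\to[0,1]^2$, by gluing, for every $i$, the left side of $P_i$ to the right side of $P_{\sigma(i)}$ and the top side of $P_i$ to the bottom side of $P_{\tau(i)}$, by translation. It carries the length metric and normalised Lebesgue measure from the squares. Action. Let $a_2=\begin{pmatrix}1&2\\0&1\end{pmatrix}$, $b_2=\begin{pmatrix}1&0\\2&1\end{pmatrix}$, which freely generate a free group $\mathbb{F}_2$. Define $h_i\colon\mathbb{R}\times[0,1]\to Z_g$ by $h_i(x,y)=\rho_{\sigma^{-j}(i)}^{-1}(x-j,y)$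 for $x\in[j,j+1]$, $j\in\mathbb{Z}$, and $v_i\colon[0,1]\times\mathbb{R}\to Z_g$ by $v_i(x,y)=\rho_{\tau^{j}(i)}^{-1}(x,y-j)$ for $y\in[j,j+1]$. The generators act on $p\in P_i$ by $a_2.p=h_i(a_2\rho_i(p))$, $b_2.p=v_i(b_2\rho_i(p))$; this is a well-defined action by measure-preserving Lipschitz homeomorphisms (with spectral gap). Warped cone. For a compact metric space $(Y,d)$ with an action by homeomorphisms of a finitely generated group $G$ with finite symmetric generating set $S$, and $t>0$, let $d_G$ be the largest metric on $\{t\}\times Y$ with $d_G((t,y),(t,y'))\leqslant t\,d(y,y')$ and $d_G((t,y),(t,s.y))\leqslant1$ ($s\in S$). The warped cone $\mathcal{O}_GY$ is the sequence $(\{t\}\times Y,d_G)_{t\in\mathbb{N}}$. Expander. A sequence of finite graphs $\Gamma_n=(V_n,E_n)$ with $|V_n|\to\infty$, uniformly bounded degrees, and Cheeger constants $\min\{|\partial A|/|A| : A\subseteq V_n,\ 1\leqslant|A|\leqslant\frac12|V_n|\}$ bounded below by a positive constant. Coarse notions (uniform for sequences). $(X_n)_n$, $(Y_n)_n$ are coarsely equivalent if there are $f_n\colon X_n\to Y_n$, non-decreasing $\eta,\zeta\colon[0,\infty)\to[0,\infty)$ with $\lim_{r\to\infty}\eta(r)=\infty$, and $A\geqslant0$, all independent of $n$ (except $f_n$), with $\eta(d(x,x'))\leqslant d(f_n(x),f_n(x'))\leqslant\zeta(d(x,x'))$ and $d(y,f_n(X_n))\leqslant A$ for all $n$, $x,x'\in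 X_n$, $y\in Y_n$. They are quasi-isometric if this holds with $\eta(s)=\max(0,L^{-1}s-A)$, $\zeta(s)=Ls+A$ for some $L\geqslant1$. Box space. For a group $G$ generated by a finite set $S$, let $(G_n)_n$ be finite-index normal subgroups such that for every $R\in\mathbb{N}$ there is $n_0$ with $B(1_G,R)\cap\bigcup_{n\geqslant n_0}G_n=\{1_G\}$. The sequence $(\mathrm{Cay}(G/G_n,S_n))_n$, with $S_n$ the image of $S$, defines a box space of $G$ (we identify the box space with this sequence). Discrete fundamental group. Let $X$ be a metric space with basepoint $x_*$ and $r>0$. An $r$-loop at $x_*$ is a sequence $(x_0,\dots,x_n)$ with $x_0=x_n=x_*$ and $d(x_i,x_{i+1})\leqslant r$. $r$-homotopy is the equivalence relation on $r$-loops generated by identifying $(x_0,\dots,x_n)$ with $(x_*,x_0,\dots,x_n)$ and $(x_0,\dots,x_n,x_* )$, and identifying loops $(x_i)_{i=0}^n$, $(y_i)_{i=0}^n$ of equal length with $d(x_i,y_i)\leqslant r$ for all $i$. $\pi_{1,r}(X,x_* )$ is the group of $r$-homotopy classes under concatenation. *)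

(* Defs.v *)
From HB Require Import structures.
From Stdlib Require Import Relations.Relation_Operators.
From mathcomp Require Import all_boot all_order all_algebra all_fingroup.
From mathcomp Require Import all_classical all_reals all_analysis.

Set Implicit Arguments.
Unset Strict Implicit.
Unset Printing Implicit Defensive.

Import Order.TTheory GRing.Theory Num.Theory.
Import numFieldNormedType.Exports.

Local Open Scope classical_set_scope.
Local Open Scope ring_scope.

(* Spaces whose metric is constructed below are given as a carrier together
   with a distance function [d : X -> X -> R]; a sequence of metric spaces is
   a family [X : nat -> Type] with [d : forall n, X n -> X n -> R]. *)

Section Metrics.
Variable R : realType.

Definition is_metric (X : Type) (d : X -> X -> R) : Prop :=
  [/\ forall x y, 0 <= d x y,
      forall x y, d x y = 0 <-> x = y,
      forall x y, d x y = d y x &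
      forall x y z, d x z <= d x y + d y z].

End Metrics.

Section Coarse.
Variables (R : realType) (X Y : nat -> Type).
Variables (dX : forall n, X n -> X n -> R) (dY : forall n, Y n -> Y n -> R).

(* The distance from a point to the image is taken in [\bar R], so that it is
   [+oo] when [X n] is empty. *)
Definition coarse_with (eta zeta : R -> R) (A : R) : Prop :=
  exists f : forall n, X n -> Y n, forall n,
    (forall x x', eta (dX x x') <= dY (f n x) (f n x') <= zeta (dX x x')) /\
    (forall y, (ereal_inf [set (dY y (f n x))%:E | x in [set: X n]]
                  <= A%:E)%E).

Definition coarsely_equivalent : Prop :=
  exists eta zeta : R -> R, exists A : R,
    [/\ forall s : R, 0 <= s -> 0 <= eta s /\ 0 <= zeta s,
        forall s s' : R, 0 <= s -> s <= s' ->
          eta s <= eta s' /\ zeta s <= zeta s',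
        eta s @[s --> +oo] --> +oo,
        0 <= A &
        coarse_with eta zeta A].

Definition quasi_isometric : Prop :=
  exists L A : R, [/\ 1 <= L, 0 <= A &
    coarse_with (fun s => Num.max 0 (L^-1 * s - A)) (fun s => L * s + A) A].

End Coarse.

Section DiscreteFundamentalGroup.
Variables (R : realType) (X : Type) (d : X -> X -> R) (r : R) (x0 : X).

(* The loop (x_0, ..., x_n) is stored as its tail (x_1, ..., x_n), since
   x_0 is the basepoint. *)
Record rloop := RLoop {
  rloop_tail : seq X;
  rloop_path : path (fun u v => d u v <= r) x0 rloop_tail;
  rloop_closed : last x0 rloop_tail = x0 }.

HB.instance Definition _ := gen_eqMixin rloop.
HB.instance Definition _ := gen_choiceMixin rloop.

Definition rloop_const : rloop := @RLoop [::] isT erefl.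

Inductive rhomotopy_step (l l' : rloop) : Prop :=
| Prepend of rloop_tail l' = x0 :: rloop_tail l
| Append of rloop_tail l' = rcons (rloop_tail l) x0
| Close of all2 (fun u v => d u v <= r) (rloop_tail l) (rloop_tail l').

Definition rhomotopic : rel rloop :=
  fun l l' => `[< clos_refl_sym_trans rloop rhomotopy_step l l' >].

Fact rhomotopic_refl : reflexive rhomotopic.
Proof. by move=> l; apply/asboolP; exact: rst_refl. Qed.

Fact rhomotopic_sym : symmetric rhomotopic.
Proof. by move=> l l'; apply/asboolP/asboolP; exact: rst_sym. Qed.

Fact rhomotopic_trans : transitive rhomotopic.
Proof.
by move=> m l n /asboolP lm /asboolP mn; apply/asboolP; exact: rst_trans lm mn.
Qed.

Canonical rhomotopic_equiv :=
  EquivRel rhomotopic rhomotopic_refl rhomotopic_sym rhomotopic_trans.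

Definition pi1r := {eq_quot rhomotopic_equiv}%qT.

(* The class of the constant loop is the neutral element for concatenation. *)
Definition pi1r_one : pi1r := (\pi_(pi1r) rloop_const)%qT.

Definition pi1r_vanishes : Prop := forall c : pi1r, c = pi1r_one.

End DiscreteFundamentalGroup.

(* The path metric of a graph. It is only used for connected graphs; between
   different components the infimum is over the empty set and takes the
   value 0. *)
Definition graph_dist (R : realType) (V : Type) (E : V -> V -> Prop)
    (x y : V) : R :=
  inf [set (size p)%:R | p in
         [set p | path (fun u v => `[< E u v >]) x p /\ last x p = y]].

Section Expander.
Variable R : realType.

Definition edge_boundary (V : finType) (e : rel V) (A : {set V}) :
    {set V * V} :=
  [set p : V * V | [&& p.1 \in A, p.2 \notin A & e p.1 p.2]].

(* A minimum over an empty family of sets (when [V] has at most one vertex)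
   is [+oo]. *)
Definition cheeger (V : finType) (e : rel V) : \bar R :=
  \big[Order.min/+oo%E]_(A : {set V} | (1 <= #|A|)%N && (2 * #|A| <= #|V|)%N)
     (#|edge_boundary e A|%:R / #|A|%:R)%:E.

Definition expander (V : nat -> finType) (e : forall n, rel (V n)) : Prop :=
  [/\ forall n, symmetric (e n) /\ irreflexive (e n),
      #|V n| @[n --> \oo] --> \oo,
      exists D : nat, forall n x, (#|[pred y | e n x y]| <= D)%N &
      exists2 c : R, 0 < c & forall n, (c%:E <= cheeger (e n))%E].

End Expander.

Section Groups.
Local Open Scope group_scope.
Variable G : groupType.
Implicit Types (S N : set G).

Definition word_ball S (k : nat) : set G :=
  [set g | exists w : seq G,
     [/\ (size w <= k)%N,
         forall s, s \in w -> S s \/ S s^-1 &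
         g = \prod_(s <- w) s]].

Definition generates S : Prop := forall g, exists k, word_ball S k g.

Definition symmetric_set S : Prop := forall s, S s -> S s^-1.

Definition normal_subgroup N : Prop :=
  [/\ N 1,
      forall x y, N x -> N y -> N (x * y),
      forall x, N x -> N x^-1 &
      forall x g, N x -> N (x ^ g)].

Definition coset_set N (g : G) : set G := [set g * x | x in N].

Definition quotient_group N : Type :=
  {C : set G | exists g, C = coset_set N g}.

Definition finite_index N : Prop :=
  finite_set [set coset_set N g | g in [set: G]].

Definition cayley_quotient S N (C D : quotient_group N) : Prop :=
  exists g s, [/\ S s \/ S s^-1, sval C = coset_set N g &
                  sval D = coset_set N (g * s)].

Definition box_filtration S (N : nat -> set G) : Prop :=
  (forall n, normal_subgroup (N n) /\ finite_index (N n)) /\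
  (forall k, exists n0,
     word_ball S k `&` \bigcup_(n in [set n | (n0 <= n)%N]) N n = [set 1]).

Definition group_action (Y : Type) (act : G -> Y -> Y) : Prop :=
  (forall y, act 1 y = y) /\
  (forall g h y, act (g * h) y = act g (act h y)).

Definition free_action (Y : Type) (act : G -> Y -> Y) : Prop :=
  forall g y, act g y = y -> g = 1.

End Groups.

Section WarpedCone.
Variables (R : realType) (G : groupType) (S : set G).
Variables (Y : Type) (d : Y -> Y -> R) (act : G -> Y -> Y).

Definition warped_admissible (t : R) (rho : Y -> Y -> R) : Prop :=
  [/\ is_metric rho,
      forall y y', rho y y' <= t * d y y' &
      forall s y, S s -> rho y (act s y) <= 1].

(* The largest admissible metric is the pointwise supremum. *)
Definition warped_dist (t : R) (y y' : Y) : R :=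
  sup [set rho y y' | rho in warped_admissible t].

(* The levels are t = 1, 2, 3, and so on. *)
Definition warped_cone (n : nat) : Y -> Y -> R := warped_dist n.+1%:R.

End WarpedCone.

Definition is_manifold (R : realType) (Y : topologicalType) : Prop :=
  exists k : nat, forall p : Y,
  exists (U : set Y) (phi : Y -> 'rV[R]_k) (psi : 'rV[R]_k -> Y),
    [/\ open U /\ U p,
        open (phi @` U),
        {within U, continuous phi},
        {within phi @` U, continuous psi} &
        forall y, U y -> psi (phi y) = y].

Definition mx2 (A : pzRingType) (a b c d : A) : 'M[A]_2 :=
  \matrix_(i, j) if i == 0 then (if j == 0 then a else b)
                 else (if j == 0 then c else d).

Definition a2 : 'M[int]_2 := mx2 1 2 0 1.
Definition b2 : 'M[int]_2 := mx2 1 0 2 1.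

Inductive in_F2 : 'M[int]_2 -> Prop :=
| F2_one : in_F2 1
| F2_a2 : in_F2 a2
| F2_b2 : in_F2 b2
| F2_mul M N of in_F2 M & in_F2 N : in_F2 (M * N)
| F2_inv M of in_F2 M : in_F2 M^-1.

Definition F2 : Type := {M : 'M[int]_2 | `[< in_F2 M >]}.

HB.instance Definition _ := SubChoice.on F2.

Lemma det_mx2 (A : comPzRingType) (a b c d : A) :
  \det (mx2 a b c d) = a * d - b * c.
Proof.
rewrite (expand_det_row _ 0) !big_ord_recl big_ord0 /cofactor !det_mx11 !mxE /=.
by rewrite addr0 expr0 mul1r expr1 mulN1r mulrN.
Qed.

Lemma in_F2_unit M : in_F2 M -> M \is a GRing.unit.
Proof.
elim=> [|||M1 N1 _ uM _ uN|M1 _ uM].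
- exact: unitr1.
- by rewrite unitmxE det_mx2.
- by rewrite unitmxE det_mx2.
- by rewrite unitrMl.
- by rewrite unitrV.
Qed.

Definition mkF2 M (h : in_F2 M) : F2 := exist _ M (introT (asboolP _) h).
Definition F2P (x : F2) : in_F2 (val x) := elimT (asboolP _) (valP x).

Definition F2one : F2 := mkF2 F2_one.
Definition F2inverse (x : F2) : F2 := mkF2 (F2_inv (F2P x)).
Definition F2product (x y : F2) : F2 := mkF2 (F2_mul (F2P x) (F2P y)).

Fact F2mulA : associative F2product.
Proof. by move=> x y z; apply/val_inj; rewrite /= mulrA. Qed.
Fact F2mul1 : left_id F2one F2product.
Proof. by move=> x; apply/val_inj; rewrite /= mul1r. Qed.
Fact F2mulr1 : right_id F2one F2product.
Proof. by move=> x; apply/val_inj; rewrite /= mulr1. Qed.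
Fact F2mulV : left_inverse F2one F2inverse F2product.
Proof.
by move=> x; apply/val_inj; rewrite /= mulVr ?in_F2_unit//; exact: F2P.
Qed.
Fact F2mulrV : right_inverse F2one F2inverse F2product.
Proof.
by move=> x; apply/val_inj; rewrite /= mulrV ?in_F2_unit//; exact: F2P.
Qed.

HB.instance Definition _ :=
  isGroup.Build F2 F2mulA F2mul1 F2mulr1 F2mulV F2mulrV.

Definition gen_a : F2 := mkF2 F2_a2.
Definition gen_b : F2 := mkF2 F2_b2.

Section Staircase.
Variables (R : realType) (g : nat).

(* For g > 0 this is 'I_(2g-1); the squares are numbered from 0. *)
Definition squares := 'I_(g.-1.*2).+1.

Definition sigma : {perm squares} :=
  (\prod_(k < g.-1) tperm (inord k.*2) (inord k.*2.+1))%g.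

Definition tau : {perm squares} :=
  (\prod_(k < g.-1) tperm (inord k.*2.+1) (inord k.*2.+2))%g.

Definition perm_zpow (s : {perm squares}) (j : int) : {perm squares} :=
  match j with Posz n => s ^+ n | Negz n => s ^- n.+1 end%g.

Definition in_square (p : R * R) : bool :=
  (0 <= p.1 <= 1) && (0 <= p.2 <= 1).

Definition unit_square : Type := {p : R * R | in_square p}.

HB.instance Definition _ := SubChoice.on unit_square.

Fact in_square0 : in_square (0, 0).
Proof. by rewrite /in_square /= lexx ler01. Qed.

Definition corner : unit_square := exist _ (0, 0) in_square0.

(* The pair [(i, p)] stands for the point of P_i with coordinates [p]. *)
Definition square_point := (squares * unit_square)%type.

Inductive glue (p q : square_point) : Prop :=
| Glue_left_right of q.1 = sigma p.1 & (val p.2).1 = 0 & (val q.2).1 = 1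
    & (val p.2).2 = (val q.2).2
| Glue_top_bottom of q.1 = tau p.1 & (val p.2).2 = 1 & (val q.2).2 = 0
    & (val p.2).1 = (val q.2).1.

Definition glued : rel square_point :=
  fun p q => `[< clos_refl_sym_trans square_point glue p q >].

Fact glued_refl : reflexive glued.
Proof. by move=> l; apply/asboolP; exact: rst_refl. Qed.

Fact glued_sym : symmetric glued.
Proof. by move=> l l'; apply/asboolP/asboolP; exact: rst_sym. Qed.

Fact glued_trans : transitive glued.
Proof.
by move=> m l n /asboolP lm /asboolP mn; apply/asboolP; exact: rst_trans lm mn.
Qed.

Canonical glued_equiv := EquivRel glued glued_refl glued_sym glued_trans.

Definition Zg := {eq_quot glued_equiv}%qT.

Definition Zpoint (i : squares) (p : unit_square) : Zg := (\pi_(Zg) (i, p))%qT.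

Definition euclid (p q : R * R) : R :=
  Num.sqrt ((p.1 - q.1) ^+ 2 + (p.2 - q.2) ^+ 2).

(* [polyline z w l]: a path of length [l] from [z] to [w] which is a
   concatenation of straight segments, each contained in one square. *)
Inductive polyline (z : Zg) : Zg -> R -> Prop :=
| Polyline_nil : polyline z z 0
| Polyline_step i p q l of polyline z (Zpoint i p) l :
    polyline z (Zpoint i q) (l + euclid (val p) (val q)).

Definition Zdist (z w : Zg) : R := inf [set l | polyline z w l].

(* [rho_inv i] is only meaningful on the unit square. *)
Definition rho_inv (i : squares) (p : R * R) : Zg := Zpoint i (insubd corner p).

(* At an integer x the formula gives the same point of the surface for the two
   possible values j = x and j = x - 1; the floor selects j = x. *)
Definition hmap (i : squares) (p : R * R) : Zg :=
  let j := Num.floor p.1 in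
  rho_inv (perm_zpow sigma (- j) i) (p.1 - j%:~R, p.2).

Definition vmap (i : squares) (p : R * R) : Zg :=
  let j := Num.floor p.2 in
  rho_inv (perm_zpow tau j i) (p.1, p.2 - j%:~R).

Definition lin_act (M : 'M[int]_2) (p : R * R) : R * R :=
  ((M 0 0)%:~R * p.1 + (M 0 1)%:~R * p.2, (M 1 0)%:~R * p.1 + (M 1 1)%:~R * p.2).

(* Since [gen_a] and [gen_b] generate [F2], there is only one such action. *)
Definition multitwist_action (act : F2 -> Zg -> Zg) : Prop :=
  [/\ group_action act,
      forall i p, act gen_a (Zpoint i p) = hmap i (lin_act a2 (val p)) &
      forall i p, act gen_b (Zpoint i p) = vmap i (lin_act b2 (val p))].

End Staircase.

(* Main.v *)
(* A cocycle at scale r on a metric space X with values in a group K is a map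
   c : X -> X -> K with c(x,y) c(y,z) = c(x,z) for nearby points. Discrete simple
   connectivity at scale r amounts to every such cocycle being a coboundary
   f(x)^-1 f(y): the classes of the triangles based at a point form a universal cocycle
   with values in the discrete fundamental group. Cocycles, unlike homotopies, are
   transported along coarse equivalences by mere composition.

   For the staircase, a cocycle on the warped cone is developed along each horizontal
   strip, giving a primitive F_i. The jump c(p, a.p) agrees with the parallel transport
   from p to a.p along the strip: the two differ by a locally constant function, which
   is trivial at the bottom of the strip, fixed by a. At height 1 the shear returns to
   the same point after two squares, and at height 1/2 after one square if sigma fixes the
   square; hence the holonomy along every horizontal cylinder is trivial, and so is,
   symmetrically, the one along every vertical cylinder. The graph of squares then
   becomes a line (square k is adjacent to square k+1), and the F_i can be normalised
   along this line so as to match on all glued sides.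

   Conversely, the quotients G/N_n of a box space carry the cocycle with values in G that
   lifts a short displacement to the unique short element of G, and a free warped cone
   carries the cocycle (y,y') |-> h^-1 where h is the unique short element with y' close
   to h.y. If these were coboundaries, then N_n would be trivial, respectively no
   nontrivial h could move a point within its component. *)
From HB Require Import structures.
From Stdlib Require Import Relations.Relation_Operators.
Require Import Defs.
From mathcomp Require Import all_boot all_order all_algebra all_fingroup.
From mathcomp Require Import all_classical all_reals all_analysis.
From mathcomp Require Import ring lra zify.

Set Implicit Arguments.
Unset Strict Implicit.
Unset Printing Implicit Defensive.

Import Order.TTheory GRing.Theory Num.Theory.
Import numFieldNormedType.Exports.

Local Open Scope classical_set_scope.
Local Open Scope ring_scope.

(** * The discrete fundamental group as a group *)

Lemma all2_cat (A B : Type) (p : A -> B -> bool) s1 t1 s2 t2 :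
  size s1 = size t1 -> all2 p (s1 ++ s2) (t1 ++ t2) = all2 p s1 t1 && all2 p s2 t2.
Proof. by elim: s1 t1 => [|x s1 ih] [|y t1] //= [/ih ->]; rewrite andbA. Qed.

Section Homotopy.
Variables (R : realType) (X : Type) (d : X -> X -> R) (r : R) (x0 : X).
Hypothesis r0 : 0 <= r.
Hypothesis dxx : forall x, d x x = 0.
Hypothesis dC : forall x y, d x y = d y x.

Local Notation near := (fun u v => d u v <= r).

Definition is_loop (l : seq X) : Prop := path near x0 l /\ last x0 l = x0.

(** Quantifying over all loops with the given tails avoids carrying proofs; the relation is vacuous
    on sequences that are not loops, so transitivity needs the middle one to be a loop. *)
Definition loop_hom (l l' : seq X) : Prop :=
  forall L L' : rloop d r x0, rloop_tail L = l -> rloop_tail L' = l' ->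
    rhomotopic L L'.



Lemma rloop_is_loop (L : rloop d r x0) : is_loop (rloop_tail L).
Proof. by case: L. Qed.

Lemma rloop_ext (L L' : rloop d r x0) : rloop_tail L = rloop_tail L' -> L = L'.
Proof.
case: L L' => l p q [l' p' q'] /= E; subst l'.
by congr RLoop; exact: Prop_irrelevance.
Qed.

Lemma loop_hom_step l l' :
  (forall L L' : rloop d r x0, rloop_tail L = l -> rloop_tail L' = l' ->
     rhomotopy_step L L') -> loop_hom l l'.
Proof. by move=> h L L' ? ?; apply/asboolP/rst_step/h. Qed.

Lemma loop_hom_refl l : loop_hom l l.
Proof.
move=> L L' e1 e2; rewrite (@rloop_ext L L') ?e1 ?e2//; exact: rhomotopic_refl.
Qed.

Lemma loop_hom_sym l l' : loop_hom l l' -> loop_hom l' l.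
Proof. by move=> h L L' e1 e2; rewrite rhomotopic_sym; exact: h. Qed.

Lemma loop_hom_trans l1 l2 l3 : is_loop l2 ->
  loop_hom l1 l2 -> loop_hom l2 l3 -> loop_hom l1 l3.
Proof.
move=> [p q] h1 h2 L L' e1 e2.
exact: rhomotopic_trans (h1 L (RLoop p q) e1 erefl) (h2 (RLoop p q) L' erefl e2).
Qed.

Lemma is_loop_cat l l' : is_loop l -> is_loop l' -> is_loop (l ++ l').
Proof.
by move=> [p q] [p' q']; split; rewrite ?cat_path ?last_cat q ?p.
Qed.

Lemma all2_near_refl l : all2 near l l.
Proof. by elim: l => //= x l ->; rewrite dxx r0. Qed.

Lemma all2_near_shift x l : path near x l -> all2 near (rcons l (last x l)) (x :: l).
Proof.
elim: l x => [|y l ih] x /=; first by rewrite dxx r0.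
by move=> /andP[xy /ih ->]; rewrite dC xy.
Qed.

Lemma is_loop_rcons l : is_loop l -> is_loop (rcons l x0).
Proof. by move=> [p q]; split; rewrite ?rcons_path ?last_rcons// p q dxx. Qed.

(* Append the basepoint, then move every point of the tail one step forward. *)
Lemma loop_hom_insert l1 l2 : is_loop (l1 ++ l2) ->
  is_loop (l1 ++ last x0 l1 :: l2) /\
  loop_hom (l1 ++ l2) (l1 ++ last x0 l1 :: l2).
Proof.
move=> h; have [p q] := h; move: p q; rewrite cat_path last_cat => /andP[p1 p2] q.
have h' : is_loop (l1 ++ last x0 l1 :: l2).
  by split; rewrite ?cat_path ?last_cat //= p1 p2 dxx r0.
split=> //; apply: (@loop_hom_trans _ (rcons (l1 ++ l2) x0)).
- exact: is_loop_rcons.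
- apply: loop_hom_step => L L' e1 e2.
  by apply: Append; rewrite e1 e2.
- apply: loop_hom_step => L L' e1 e2.
  apply: Close; rewrite e1 e2 rcons_cat all2_cat// all2_near_refl /=.
  by rewrite -{1}q; exact: all2_near_shift.
Qed.

Lemma loop_hom_change l1 y y' l2 : is_loop (l1 ++ y :: l2) ->
  is_loop (l1 ++ y' :: l2) -> d y y' <= r ->
  loop_hom (l1 ++ y :: l2) (l1 ++ y' :: l2).
Proof.
move=> h h' yy'; apply: loop_hom_step => L L' e1 e2; apply: Close.
by rewrite e1 e2 all2_cat // all2_near_refl/= yy' all2_near_refl.
Qed.

(** Repeat the last vertex of [l1], then move the second copy to [y], which is within [r] of it. *)
Lemma loop_hom_triangle l1 y z l2 : is_loop (l1 ++ z :: l2) ->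
  is_loop (l1 ++ y :: z :: l2) ->
  loop_hom (l1 ++ y :: z :: l2) (l1 ++ z :: l2).
Proof.
move=> h h'; have [h2 h3] := loop_hom_insert h.
apply: loop_hom_sym; apply: (loop_hom_trans h2 h3).
apply: loop_hom_change => //.
by case: h' => [+ _]; rewrite cat_path => /andP[_ /andP[]].
Qed.

(** A detour is retracted from its far end: the tip [y] is removed as the apex of a degenerate
    triangle, and the vertex before it, now repeated, is merged. *)
Lemma loop_hom_spur l1 q l2 : is_loop (l1 ++ l2) -> path near (last x0 l1) q ->
  is_loop (l1 ++ (q ++ rev (belast (last x0 l1) q)) ++ l2) /\
  loop_hom (l1 ++ (q ++ rev (belast (last x0 l1) q)) ++ l2) (l1 ++ l2).
Proof.
move=> h; elim/last_ind: q => [|q y ih].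
  by move=> _; split=> //; exact: loop_hom_refl.
rewrite rcons_path => /andP[pq qy]; have [ih1 ih2] := ih pq.
rewrite belast_rcons.
set a := last x0 l1 in pq qy ih1 ih2 *.
set b := last a q in qy *.
have e1 : l1 ++ (q ++ rev (belast a q)) ++ l2 = (l1 ++ q) ++ rev (belast a q) ++ l2.
  by rewrite !catA.
have e2 : l1 ++ (rcons q y ++ rev (a :: q)) ++ l2 =
   (l1 ++ q) ++ y :: b :: rev (belast a q) ++ l2.
  by rewrite lastI rev_rcons -cats1 -!catA.
rewrite e2; rewrite e1 in ih1 ih2.
have lb : last x0 (l1 ++ q) = b by rewrite last_cat.
have [i1 i2] := loop_hom_insert ih1; rewrite lb in i1 i2.
have i3 : is_loop ((l1 ++ q) ++ y :: b :: rev (belast a q) ++ l2).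
  move: i1 => [p q1]; split; last by move: q1; rewrite !last_cat.
  move: p; rewrite !(cat_path _ _ (l1 ++ q)) lb /= => /and3P[-> _ ->].
  by rewrite qy dC qy.
split=> //.
apply: (loop_hom_trans i1); first exact: loop_hom_triangle.
exact: loop_hom_trans ih1 (loop_hom_sym i2) ih2.
Qed.

(** Only the prepending move ceases to be a single move once [m] stands in front: the basepoint is
    then inserted in the middle. On the other side the same happens to appending. *)
Lemma loop_hom_catl m l l' : is_loop m -> is_loop l -> is_loop l' ->
  (forall L L' : rloop d r x0, rloop_tail L = l -> rloop_tail L' = l' ->
     rhomotopy_step L L') -> loop_hom (m ++ l) (m ++ l').
Proof.
move=> hm h h' st.
have := st (RLoop h.1 h.2) (RLoop h'.1 h'.2) erefl erefl; case=> /= [e|e|e].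
- have := (loop_hom_insert (is_loop_cat hm h)).2.
  by rewrite e (hm.2).
- by rewrite e -rcons_cat; apply: loop_hom_step => L L' e1 e2; apply: Append; rewrite e1 e2.
- apply: loop_hom_step => L L' e1 e2; apply: Close; rewrite e1 e2 all2_cat ?all2_near_refl//.
Qed.

Lemma loop_hom_catr m l l' : is_loop m -> is_loop l -> is_loop l' ->
  (forall L L' : rloop d r x0, rloop_tail L = l -> rloop_tail L' = l' ->
     rhomotopy_step L L') -> loop_hom (l ++ m) (l' ++ m).
Proof.
move=> hm h h' st.
have := st (RLoop h.1 h.2) (RLoop h'.1 h'.2) erefl erefl; case=> /= [e|e|e].
- by rewrite e; apply: loop_hom_step => L L' e1 e2; apply: Prepend; rewrite e1 e2.
- have := (loop_hom_insert (is_loop_cat h hm)).2.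
  by rewrite e h.2 cat_rcons.
- apply: loop_hom_step => L L' e1 e2; apply: Close; rewrite e1 e2 all2_cat ?e ?all2_near_refl//.
  by move: e; rewrite all2E => /andP[/eqP].
Qed.


Definition loop_of (l : seq X) (h : is_loop l) : rloop d r x0 := RLoop h.1 h.2.

Definition loop_cat (L M : rloop d r x0) : rloop d r x0 :=
  loop_of (is_loop_cat (rloop_is_loop L) (rloop_is_loop M)).

Lemma rhomotopic_cat L L' M M' : rhomotopic L L' -> rhomotopic M M' ->
  rhomotopic (loop_cat L M) (loop_cat L' M').
Proof.
move=> /asboolP hL /asboolP hM; apply: (@rhomotopic_trans _ _ _ _ _ (loop_cat L' M)).
  elim: hL => {L L'} [L L' h|L|L L' _|L1 L2 L3 _ h1 _ h2].
  - apply: (@loop_hom_catr (rloop_tail M) (rloop_tail L) (rloop_tail L')) => //;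
      try exact: rloop_is_loop.
    by move=> L1 L1' /rloop_ext -> /rloop_ext ->.
  - exact: rhomotopic_refl.
  - by rewrite rhomotopic_sym.
  - exact: rhomotopic_trans h1 h2.
elim: hM => {M M'} [M M' h|M|M M' _|L1 L2 L3 _ h1 _ h2].
- apply: (@loop_hom_catl (rloop_tail L') (rloop_tail M) (rloop_tail M')) => //;
    try exact: rloop_is_loop.
  by move=> L1 L1' /rloop_ext -> /rloop_ext ->.
- exact: rhomotopic_refl.
- by rewrite rhomotopic_sym.
- exact: rhomotopic_trans h1 h2.
Qed.

Lemma rev_pathP x l : path near x l ->
  path near (last x l) (rev (belast x l)) /\ last (last x l) (rev (belast x l)) = x.
Proof.
move=> p; split.
  rewrite rev_path; apply: sub_path p => u v /=; by rewrite dC.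
by case: l {p} => //= y l; rewrite rev_cons last_rcons.
Qed.

Lemma is_loop_rev l : is_loop l -> is_loop (rev (belast x0 l)).
Proof. by move=> [p q]; have := rev_pathP p; rewrite q. Qed.

Definition loop_rev (L : rloop d r x0) : rloop d r x0 :=
  loop_of (is_loop_rev (rloop_is_loop L)).

Lemma loop_rev_tail (L : rloop d r x0) :
  rloop_tail (loop_rev L) = rev (belast x0 (rloop_tail L)).
Proof. by []. Qed.

Lemma loop_revK : involutive loop_rev.
Proof.
move=> L; apply: rloop_ext; rewrite !loop_rev_tail.
have := rloop_closed L; case: (lastP (rloop_tail L)) => // l x.
rewrite last_rcons => ->; rewrite belast_rcons rev_cons belast_rcons rev_cons.
by rewrite revK.
Qed.

Lemma loop_cat_rev L : rhomotopic (loop_cat L (loop_rev L)) (rloop_const d r x0).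
Proof.
have h : is_loop ([::] ++ [::]) by [].
have [h1] := loop_hom_spur h (rloop_path L).
by apply=> //=; rewrite cats0.
Qed.

(** The metric facts are arguments of the type because the group axioms depend on them and the
    canonical instance has to recover them from the type. *)
Definition loop_group (_ : 0 <= r) (_ : forall x, d x x = 0)
  (_ : forall x y, d x y = d y x) : Type := pi1r d r x0.
HB.instance Definition _ h1 h2 h3 :=
  Choice.copy (loop_group h1 h2 h3) (pi1r d r x0).
Local Notation pi1_group := (loop_group r0 dxx dC).

Definition pi1_class (L : rloop d r x0) : pi1_group := (\pi_(pi1r d r x0) L)%qT.
Definition pi1_rep (a : pi1_group) : rloop d r x0 :=
  generic_quotient.repr (a : pi1r d r x0).
Definition pi1_mul (a b : pi1_group) : pi1_group :=
  pi1_class (loop_cat (pi1_rep a) (pi1_rep b)).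
Definition pi1_inv (a : pi1_group) : pi1_group :=
  pi1_class (loop_rev (pi1_rep a)).

Lemma pi1_classP L L' : pi1_class L = pi1_class L' <-> rhomotopic L L'.
Proof. by split=> [/eqmodP|?]; last exact/eqmodP. Qed.

Lemma pi1_class_repr (a : pi1_group) : pi1_class (pi1_rep a) = a.
Proof. exact: reprK. Qed.

Lemma pi1_mulE L M : pi1_mul (pi1_class L) (pi1_class M) = pi1_class (loop_cat L M).
Proof. by apply/pi1_classP/rhomotopic_cat; apply/pi1_classP/pi1_class_repr. Qed.

Lemma pi1_classW (P : pi1_group -> Prop) : (forall L, P (pi1_class L)) -> forall a, P a.
Proof. by move=> h a; rewrite -(pi1_class_repr a). Qed.

Fact pi1_mulA : associative pi1_mul.
Proof.
elim/pi1_classW => L; elim/pi1_classW => M; elim/pi1_classW => N.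
by rewrite !pi1_mulE; congr pi1_class; apply: rloop_ext => /=; rewrite catA.
Qed.

Fact pi1_mul1g : left_id (pi1_class (rloop_const d r x0)) pi1_mul.
Proof.
by elim/pi1_classW => L; rewrite pi1_mulE; congr pi1_class; apply: rloop_ext.
Qed.

Fact pi1_mulg1 : right_id (pi1_class (rloop_const d r x0)) pi1_mul.
Proof.
elim/pi1_classW => L; rewrite pi1_mulE; congr pi1_class; apply: rloop_ext.
by rewrite /= cats0.
Qed.

Fact pi1_mulgV : right_inverse (pi1_class (rloop_const d r x0)) pi1_inv pi1_mul.
Proof.
move=> a; rewrite -{1}(pi1_class_repr a) /pi1_inv pi1_mulE.
exact/pi1_classP/loop_cat_rev.
Qed.

Fact pi1_mulVg : left_inverse (pi1_class (rloop_const d r x0)) pi1_inv pi1_mul.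
Proof.
move=> a; rewrite -{2}(pi1_class_repr a) /pi1_inv pi1_mulE.
apply/pi1_classP; rewrite -{2}[pi1_rep _]loop_revK; exact: loop_cat_rev.
Qed.

HB.instance Definition _ :=
  isGroup.Build (loop_group r0 dxx dC) pi1_mulA pi1_mul1g pi1_mulg1 pi1_mulVg pi1_mulgV.

Local Open Scope group_scope.

(** Total on sequences, with value 1 off the loops, so that identities can be rewritten without
    proofs inside the terms. *)
Definition seq_class (l : seq X) : pi1_group :=
  if pselect (is_loop l) is left h then pi1_class (loop_of h) else 1.

Lemma seq_classE (L : rloop d r x0) : seq_class (rloop_tail L) = pi1_class L.
Proof.
rewrite /seq_class; case: pselect => [h|[]]; last exact: rloop_is_loop.
by congr pi1_class; apply: rloop_ext.
Qed.

Lemma seq_class_of l (h : is_loop l) : seq_class l = pi1_class (loop_of h).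
Proof. exact: seq_classE (loop_of h). Qed.

Lemma seq_class_hom l l' : is_loop l -> is_loop l' -> loop_hom l l' ->
  seq_class l = seq_class l'.
Proof.
move=> h h' ll'; rewrite (seq_class_of h) (seq_class_of h').
by apply/pi1_classP; exact: ll'.
Qed.

Lemma seq_class_cat l l' : is_loop l -> is_loop l' ->
  seq_class l * seq_class l' = seq_class (l ++ l').
Proof.
move=> h h'; rewrite (seq_class_of h) (seq_class_of h').
rewrite (seq_class_of (is_loop_cat h h')) [LHS]pi1_mulE.
by congr pi1_class; apply: rloop_ext.
Qed.

Hypothesis conn : forall x, exists l, path near x0 l /\ last x0 l = x.

(** A chosen path from the basepoint to each point; [bar] is its reverse. *)
Let dl x : seq X := sval (cid (conn x)).
Let dl_path x : path near x0 (dl x).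
Proof. by rewrite /dl; case: cid => l []. Qed.
Let dl_last x : last x0 (dl x) = x.
Proof. by rewrite /dl; case: cid => l []. Qed.

Let bar x : seq X := rev (belast x0 (dl x)).
Let bar_path x : path near x (bar x).
Proof. by have [] := rev_pathP (dl_path x); rewrite dl_last. Qed.
Let bar_last x : last x (bar x) = x0.
Proof. by have [] := rev_pathP (dl_path x); rewrite dl_last. Qed.
Let rev_bar x : rev (belast x (bar x)) = dl x.
Proof.
have := dl_last x; rewrite /bar; case: (lastP (dl x)) => // l y.
by rewrite last_rcons => ->; rewrite belast_rcons rev_cons belast_rcons rev_cons revK.
Qed.

(** The universal cocycle: follow the chosen path to [x], jump to [y], and return along the chosen
    path. *)
Definition edge_class x y : pi1_group := seq_class (dl x ++ y :: bar y).

Lemma edge_class_loop l y : path near x0 l -> d (last x0 l) y <= r ->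
  is_loop (l ++ y :: bar y).
Proof.
by move=> p h; split; rewrite ?cat_path ?last_cat/= ?p ?h ?bar_path ?bar_last.
Qed.

Lemma seq_class_edge l y : path near x0 l -> d (last x0 l) y <= r ->
  seq_class (l ++ bar (last x0 l)) * edge_class (last x0 l) y =
  seq_class (l ++ y :: bar y).
Proof.
move=> p h; set x := last x0 l in h *.
have h1 : is_loop (l ++ bar x).
  by split; rewrite ?cat_path ?last_cat ?p ?bar_path ?bar_last.
have h2 : is_loop (dl x ++ y :: bar y).
  by apply: edge_class_loop; rewrite ?dl_path ?dl_last.
have h3 : is_loop (l ++ y :: bar y) by exact: edge_class_loop.
rewrite seq_class_cat//.
have [] := loop_hom_spur h3 (bar_path x); rewrite rev_bar -!catA => h4 h5.
exact: seq_class_hom.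
Qed.

Lemma edge_class_cocycle x y z : d x y <= r -> d y z <= r -> d x z <= r ->
  edge_class x y * edge_class y z = edge_class x z.
Proof.
move=> xy yz xz.
have py : path near x0 (rcons (dl x) y) by rewrite rcons_path dl_path dl_last xy.
have := @seq_class_edge (rcons (dl x) y) z py; rewrite last_rcons => /(_ yz).
rewrite -cats1 -!catA /= => ->; apply: seq_class_hom.
- by have := edge_class_loop py; rewrite last_rcons => /(_ _ yz); rewrite -cats1 -catA.
- by apply: edge_class_loop; rewrite ?dl_path ?dl_last.
- apply: loop_hom_triangle.
  + by apply: edge_class_loop; rewrite ?dl_path ?dl_last.
  + by have := edge_class_loop py; rewrite last_rcons => /(_ _ yz); rewrite -cats1 -catA.
Qed.

Lemma edge_class_trivial (f : X -> pi1_group) :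
  (forall x y, d x y <= r -> edge_class x y = (f x)^-1 * f y) ->
  pi1r_vanishes d r x0.
Proof.
move=> hf.
(* The chosen path to the basepoint itself need not be empty; hence the factor coming from [bar x0],
   cancelled at the end. *)
have key l : path near x0 l ->
    seq_class (l ++ bar (last x0 l)) = seq_class (bar x0) * ((f x0)^-1 * f (last x0 l)).
  elim/last_ind: l => [|l y ih]; first by rewrite /= mulVg mulg1.
  rewrite rcons_path last_rcons => /andP[p h].
  rewrite cat_rcons -seq_class_edge// ih// hf//.
  by rewrite -!mulgA mulKVg.
move=> c; have -> : c = pi1_class (pi1_rep c) by rewrite pi1_class_repr.
set L := pi1_rep c; rewrite -seq_classE.
have := key _ (rloop_path L); rewrite rloop_closed mulVg mulg1 => e.
have hb : is_loop (bar x0) by split; [exact: bar_path|exact: bar_last].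
rewrite -seq_class_cat// in e; last exact: rloop_is_loop.
apply: (@mulIg _ (seq_class (bar x0))); rewrite e.
by rewrite -[LHS]mul1g.
Qed.

End Homotopy.

Section Cocycles.
Variables (R : realType) (X : Type) (d : X -> X -> R).
Local Open Scope group_scope.

(** The third side is unrestricted and may be as long as [2 r], like the diagonals between two close
    loops. The weaker [triangle_cocycle] is what the universal cocycle satisfies. *)
Definition cocycle (r : R) (K : groupType) (c : X -> X -> K) : Prop :=
  forall x y z, (d x y <= r)%R -> (d y z <= r)%R -> c x y * c y z = c x z.

Definition triangle_cocycle (r : R) (K : groupType) (c : X -> X -> K) : Prop :=
  forall x y z, (d x y <= r)%R -> (d y z <= r)%R -> (d x z <= r)%R ->
    c x y * c y z = c x z.

Definition coboundary (r : R) (K : groupType) (c : X -> X -> K) : Prop :=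
  exists f : X -> K, forall x y, (d x y <= r)%R -> c x y = (f x)^-1 * f y.

End Cocycles.

Lemma pi1r_vanishes_coboundary (R : realType) (X : Type) (d : X -> X -> R)
    (r : R) (x0 : X) :
  0 <= r -> (forall x, d x x = 0) -> (forall x y, d x y = d y x) ->
  (forall x, exists l, path (fun u v => d u v <= r) x0 l /\ last x0 l = x) ->
  (forall (K : groupType) (c : X -> X -> K),
     triangle_cocycle d r c -> coboundary d r c) ->
  pi1r_vanishes d r x0.
Proof.
move=> r0 dxx dC conn /(_ _ (edge_class r0 dxx dC conn)) [].
  exact: edge_class_cocycle.
exact: edge_class_trivial.
Qed.

(** * Cocycles and coboundaries *)

Section CocycleTheory.
Variables (R : realType) (X : Type) (d : X -> X -> R) (r : R).
Hypothesis r0 : 0 <= r.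
Hypothesis dxx : forall x, d x x = 0.
Hypothesis dC : forall x y, d x y = d y x.
Variables (K : groupType) (c : X -> X -> K).
Hypothesis cc : cocycle d r c.
Local Open Scope group_scope.
Local Notation near := (fun u v => (d u v <= r)%R).

Lemma cocycle_refl x : c x x = 1.
Proof. by apply: (@mulgI _ (c x x)); rewrite mulg1 cc ?dxx. Qed.

Lemma cocycle_sym x y : (d x y <= r)%R -> c y x = (c x y)^-1.
Proof.
move=> xy; apply: (@mulgI _ (c x y)); rewrite mulgV cc// ?cocycle_refl//.
by rewrite dC.
Qed.

Fixpoint walk_prod x (l : seq X) : K :=
  if l is y :: l' then c x y * walk_prod y l' else 1.

Lemma walk_prod_cat x l l' :
  walk_prod x (l ++ l') = walk_prod x l * walk_prod (last x l) l'.
Proof. by elim: l x => [|y l ih] x /=; rewrite ?mul1g// ih mulgA. Qed.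

Lemma walk_prod_close x l x' l' : path near x l -> path near x' l' ->
  all2 near l l' -> near x x' ->
  walk_prod x l * c (last x l) (last x' l') = c x x' * walk_prod x' l'.
Proof.
elim: l x x' l' => [|y l ih] x x' [|y' l'] //= => [|/andP[xy p] /andP[xy' p']].
  by rewrite mul1g mulg1.
move=> /andP[yy' a] xx'; rewrite -mulgA ih// !mulgA; congr (_ * _).
(* Both paths around the square equal [c x y'], although [x] and [y'] may be [2 r] apart. *)
by rewrite !cc.
Qed.

Lemma walk_prod_rhomotopic x0 (L L' : rloop d r x0) : rhomotopic L L' ->
  walk_prod x0 (rloop_tail L) = walk_prod x0 (rloop_tail L').
Proof.
move=> /asboolP; elim=> {L L'} // => [L L'|L1 L2 L3 _ h1 _ h2]; last by rewrite h1.
case=> [->|->|h] /=.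
- by rewrite cocycle_refl mul1g.
- by rewrite -cats1 walk_prod_cat rloop_closed /= cocycle_refl !mulg1.
- have := walk_prod_close (rloop_path L) (rloop_path L') h.
  by rewrite !rloop_closed cocycle_refl mul1g mulg1; apply; rewrite dxx.
Qed.

Lemma walk_prod_rev x l : path near x l ->
  walk_prod (last x l) (rev (belast x l)) = (walk_prod x l)^-1.
Proof.
elim/last_ind: l => [|l y ih]; first by rewrite /= invg1.
rewrite rcons_path => /andP[p h]; rewrite last_rcons belast_rcons lastI rev_rcons/=.
by rewrite ih// -cats1 walk_prod_cat /= mulg1 invgM cocycle_sym.
Qed.

(** Products of [c] along loops are homotopy invariant, hence trivial; so the product along a path
    from [x0] depends only on its endpoint and is a primitive. *)
Lemma pi1r_vanishes_cocycle x0 :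
  (forall x, exists l, path near x0 l /\ last x0 l = x) ->
  pi1r_vanishes d r x0 -> coboundary d r c.
Proof.
move=> conn van.
have w1 l : path near x0 l -> last x0 l = x0 -> walk_prod x0 l = 1.
  move=> p q; have /eqmodP h := van (\pi_(pi1r d r x0) (RLoop p q))%qT.
  exact: walk_prod_rhomotopic h.
have [f hf] := choice conn.
exists (fun x => walk_prod x0 (f x)) => x y xy.
have [px lx] := hf x; have [py ly] := hf y.
have [q1 q2] := rev_pathP dC py.
rewrite ly in q1 q2; have e := walk_prod_rev py; rewrite ly in e.
have := w1 (f x ++ y :: rev (belast x0 (f y))).
rewrite cat_path last_cat /= px lx xy /= q1 q2 walk_prod_cat /= lx e.
by move=> /(_ erefl erefl); rewrite mulgA => /divg1_eq <-; rewrite mulKg.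
Qed.

End CocycleTheory.

(** * Path metrics of connected graphs *)

Section GraphDist.
Variables (R : realType) (V : Type) (E : V -> V -> Prop).
Hypothesis Esym : forall x y, E x y -> E y x.
Hypothesis Econn : forall x y, exists p,
  path (fun u v => `[< E u v >]) x p /\ last x p = y.
Local Notation gd := (graph_dist R E).
Local Notation Eb := (fun u v => `[< E u v >]).

Lemma graph_dist_le x p : path Eb x p -> gd x (last x p) <= (size p)%:R.
Proof.
move=> h; apply: ge_inf; last by exists p.
by exists 0 => _ [q _ <-]; exact: ler0n.
Qed.

(** Lengths of paths are natural numbers, so the infimum is attained. *)
Lemma graph_dist_geodesic x y : exists p,
  [/\ path Eb x p, last x p = y & (size p)%:R = gd x y].
Proof.
pose P k := `[< exists p, [/\ path Eb x p, last x p = y & size p = k] >].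
have exP : exists k, P k.
  by have [p [h1 h2]] := Econn x y; exists (size p); apply/asboolP; exists p.
case: (ex_minnP exP) => k /asboolP[p [h1 h2 h3]] kmin.
exists p; split=> //; apply/eqP; rewrite eq_le -{2}h2 graph_dist_le// andbT h3.
apply: lb_le_inf; first by exists (size p)%:R, p.
by move=> _ [q [q1 q2] <-]; rewrite ler_nat; apply: kmin; apply/asboolP; exists q.
Qed.

Lemma graph_dist_ge0 x y : 0 <= gd x y.
Proof. by have [p [_ _ <-]] := graph_dist_geodesic x y. Qed.

Lemma graph_dist_refl x : gd x x = 0.
Proof.
apply/eqP; rewrite eq_le graph_dist_ge0 andbT.
exact: (@graph_dist_le x [::]).
Qed.

Let graph_dist_sym_le x y : gd x y <= gd y x.
Proof.
have [p [h1 h2 <-]] := graph_dist_geodesic y x.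
have h3 : path Eb x (rev (belast y p)).
  rewrite -h2 rev_path; apply: sub_path h1 => u v /asboolP uv.
  by apply/asboolP/Esym.
have h4 : last x (rev (belast y p)) = y.
  by rewrite -h2; case: (p) => //= z l; rewrite rev_cons last_rcons.
by have := graph_dist_le h3; rewrite h4 size_rev size_belast.
Qed.

Lemma graph_dist_sym x y : gd x y = gd y x.
Proof. by apply/eqP; rewrite eq_le !graph_dist_sym_le. Qed.

Lemma graph_dist_triangle x y z : gd x z <= gd x y + gd y z.
Proof.
have [p [h1 h2 <-]] := graph_dist_geodesic x y.
have [q [h3 h4 <-]] := graph_dist_geodesic y z.
rewrite -natrD -size_cat; have -> : z = last x (p ++ q) by rewrite last_cat h2 h4.
by apply: graph_dist_le; rewrite cat_path h1 h2 h3.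
Qed.

Lemma graph_dist_edge x y : E x y -> gd x y <= 1.
Proof.
by move=> xy; apply: (@graph_dist_le x [:: y]); rewrite /= andbT; exact/asboolP.
Qed.

Lemma graph_dist_conn r x : 1 <= r -> forall y, exists l,
  path (fun u v => gd u v <= r) x l /\ last x l = y.
Proof.
move=> r1 y; have [p [h1 h2]] := Econn x y; exists p; split=> //.
by apply: sub_path h1 => u v /asboolP /graph_dist_edge /le_trans -> .
Qed.

(** All vertices of a geodesic of length at most [r] are within [r] of its origin, so the triangle
    relation applies to the origin and each edge in turn. *)
Lemma graph_coboundary r (K : groupType) (c : V -> V -> K) : 1 <= r ->
  triangle_cocycle gd r c -> coboundary gd 1 c -> coboundary gd r c.
Proof.
move=> r1 cc [f hf]; exists f => x y xy.
have [p [h1 h2 h3]] := graph_dist_geodesic x y; rewrite -h3 in xy.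
rewrite -h2 => {h2 h3}; elim/last_ind: p h1 xy => [|p z ih] /=.
  by move=> _ _; rewrite hf ?graph_dist_refl.
rewrite rcons_path last_rcons size_rcons => /andP[h1 /asboolP h2] h3.
have h4 : (size p)%:R <= r by apply: le_trans h3; rewrite ler_nat.
have h5 := graph_dist_edge h2.
rewrite -(cc x (last x p) z).
- by rewrite ih// hf// -mulgA mulKVg.
- exact: le_trans (graph_dist_le h1) h4.
- exact: le_trans h5 r1.
- apply: le_trans h3; have := @graph_dist_le x (rcons p z).
  rewrite last_rcons size_rcons; apply; rewrite rcons_path h1 /=.
  exact/asboolP.
Qed.

End GraphDist.

(** * Expanders and warped cones *)

Section ExpanderFacts.
Variables (R : realType) (V : finType) (e : rel V).
Hypothesis esym : symmetric e.

(** A component has empty edge boundary, so a positive Cheeger constant forces it to contain more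
    than half of the vertices; two such components must meet. *)
Lemma cheeger_connected (c : R) : 0 < c -> (c%:E <= cheeger R e)%E ->
  forall x y, exists p, path (fun u v => `[< e u v >]) x p /\ last x p = y.
Proof.
move=> c0 ch x y.
suff /connectP[p h1 h2] : connect e x y.
  by exists p; split=> //; apply: sub_path h1 => u v uv; exact/asboolP.
apply: contraT => nxy.
have csym : connect_sym e by exact: sym_connect_sym.
pose comp z : {set V} := [set u | connect e z u]%SET.
have big z : (#|V| < 2 * #|comp z|)%N.
  rewrite ltnNge; apply/negP => small.
  have z1 : (0 < #|comp z|)%N by apply/card_gt0P; exists z; rewrite inE connect0.
  have : (cheeger R e <= (#|edge_boundary e (comp z)|%:R / #|comp z|%:R)%:E)%E.
    by apply: bigmin_le_cond; rewrite z1 small.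
  have -> : edge_boundary e (comp z) = finset.set0.
    apply/setP => -[u v]; rewrite !inE /=; apply/negP => /and3P[zu zv uv].
    by move/negP: zv; apply; apply: connect_trans zu (connect1 uv).
  rewrite cards0 mul0r => /(le_trans ch); rewrite lee_fin => /(lt_le_trans c0).
  by rewrite ltxx.
have dis : comp x :&: comp y = finset.set0.
  apply/setP => z; rewrite !inE; apply/negP => /andP[xz yz].
  by move/negP: nxy; apply; apply: connect_trans xz _; rewrite csym.
have := cardsUI (comp x) (comp y); rewrite dis cards0.
have : (#|comp x :|: comp y| <= #|V|)%N by exact: max_card.
have := big x; have := big y; lia.
Qed.

(** Adding all neighbours multiplies the size of a set by at most [D + 1]. *)
Lemma card_le_ball (D k : nat) : (forall x, (#|[pred y | e x y]| <= D)%N) ->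
  forall x, (forall y, exists p,
    [/\ path (fun u v => `[< e u v >]) x p, last x p = y & (size p <= k)%N]) ->
  (#|V| <= D.+1 ^ k)%N.
Proof.
move=> deg x hx.
pose nb (A : {set V}) : {set V} := (A :|: \bigcup_(y in A) [set z | e y z])%SET.
pose ball j := iter j nb (finset.set1 x).
have cb j : (#|ball j| <= D.+1 ^ j)%N.
  elim: j => [|j ih]; first by rewrite cards1.
  rewrite /ball iterS -/(ball j) /nb.
  apply: leq_trans (leq_card_setU _ _).1 _.
  apply: (@leq_trans (#|ball j| + #|ball j| * D)).
    rewrite leq_add2l; apply: leq_trans (unstable.card_big_setU _ _ _) _.
    rewrite -sum_nat_const; apply: leq_sum => y _.
    by apply: leq_trans (deg y); rewrite cardsE.
  by rewrite -mulnS expnS mulnC leq_mul2l ih orbT.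
have mono j j' : (j <= j')%N -> ball j \subset ball j'.
  move=> /subnKC <-; elim: (j' - j)%N => [|i ih]; first by rewrite addn0.
  by rewrite addnS; apply: (fintype.subset_trans ih); exact: finset.subsetUl.
have inb p : path (fun u v => `[< e u v >]) x p -> last x p \in ball (size p).
  elim/last_ind: p => [|p y ih]; first by rewrite /= inE.
  rewrite rcons_path last_rcons size_rcons => /andP[/ih h /asboolP h2].
  rewrite /ball iterS -/(ball _) /nb inE; apply/orP; right.
  by apply/bigcupP; exists (last x p) => //; rewrite inE.
apply: leq_trans (cb k); rewrite -cardsT; apply/subset_leq_card/fintype.subsetP => y _.
have [p [h1 <- h3]] := hx y.
exact: (fintype.subsetP (mono _ _ h3)) (inb _ h1).
Qed.

End ExpanderFacts.

(** * The warped distance as the least cost of a chain *)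

Section WarpedChains.
Variables (R : realType) (G : groupType) (S : set G) (Y : Type).
Variables (d : Y -> Y -> R) (act : G -> Y -> Y) (t : R).
Hypothesis d0 : forall x y, 0 <= d x y.
Hypothesis dxx : forall x, d x x = 0.
Hypothesis dC : forall x y, d x y = d y x.
Hypothesis Ssym : symmetric_set S.
Hypothesis act_act : group_action act.
Hypothesis t0 : 0 <= t.

(** Here [k] counts the jumps by generators and [l] is the total length of the moves inside [Y]; the
    cost of the chain is [k + t * l]. *)
Inductive wchain (x : Y) : Y -> nat -> R -> Prop :=
| Wchain_nil : wchain x x 0 0
| Wchain_move y z k l of wchain x y k l : wchain x z k (l + d y z)
| Wchain_jump s y k l of S s & wchain x y k l : wchain x (act s y) k.+1 l.

Lemma wchain_ge0 x y k l : wchain x y k l -> 0 <= l.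
Proof. by elim=> // {}y z {}k {}l _ h; rewrite addr_ge0. Qed.

Lemma wchain_cat x y z k l k' l' : wchain x y k l -> wchain y z k' l' ->
  wchain x z (k + k')%N (l + l').
Proof.
move=> h; elim=> [|y1 z1 k1 l1 _ ih|s y1 k1 l1 Ss _ ih].
- by rewrite addn0 addr0.
- by rewrite addrA; exact: Wchain_move.
- by rewrite addnS; exact: Wchain_jump.
Qed.

Lemma wchain_move1 x y : wchain x y 0 (d x y).
Proof. by rewrite -[d x y]add0r; apply: Wchain_move (Wchain_nil x). Qed.

Lemma wchain_jump1 s x : S s -> wchain x (act s x) 1 0.
Proof. by move=> Ss; apply: Wchain_jump (Wchain_nil x). Qed.

Lemma wchain_rev x y k l : wchain x y k l -> wchain y x k l.
Proof.
elim=> [|y1 z1 k1 l1 _ ih|s y1 k1 l1 Ss _ ih]; first exact: Wchain_nil.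
- by rewrite addrC -[k1]add0n dC; apply: wchain_cat ih; exact: wchain_move1.
- rewrite -add1n -[l1]add0r; apply: wchain_cat ih.
  have := wchain_jump1 (act s y1) (Ssym Ss).
  by rewrite -act_act.2 mulVg act_act.1.
Qed.

Local Notation wd := (warped_dist S d act t).
Local Notation adm := (warped_admissible S d act t).

Lemma admissible_chain rho x y k l : adm rho -> wchain x y k l ->
  rho x y <= k%:R + t * l.
Proof.
move=> [[r0 rxx rC rt] rd rS]; elim=> [|y1 z1 k1 l1 _ ih|s y1 k1 l1 Ss _ ih].
- by rewrite mulr0 addr0 (rxx x x).2.
- by rewrite mulrDr addrA; apply: le_trans (rt _ y1 _) _; rewrite lerD.
- apply: le_trans (rt _ y1 _) _; rewrite -natr1 addrAC lerD//; exact: rS.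
Qed.

Lemma warped_dist_chain_le x y k l : wchain x y k l -> wd x y <= k%:R + t * l.
Proof.
move=> h; have h0 : 0 <= k%:R + t * l by rewrite addr_ge0 ?mulr_ge0 ?(wchain_ge0 h).
rewrite /warped_dist; set A := (X in sup X).
have [->|/set0P A0] := eqVneq A set0; first by rewrite sup0.
by apply: ge_sup => // _ [rho hr <-]; exact: admissible_chain.
Qed.

Lemma warped_dist_ge rho x y : adm rho -> rho x y <= wd x y.
Proof.
move=> hr; apply: ub_le_sup; last by exists rho.
by exists (t * d x y) => _ [r' [_ + _] <-]; apply.
Qed.

Lemma warped_dist_noadm : ~ (exists rho, adm rho) -> forall x y, wd x y = 0.
Proof.
move=> h x y; rewrite /warped_dist; set A := (X in sup X).
have -> : A = set0 by apply/seteqP; split=> // z [rho hr _]; apply: h; exists rho.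
by rewrite sup0.
Qed.

Lemma warped_dist_ge0 x y : 0 <= wd x y.
Proof.
have [[rho hr]|h] := pselect (exists rho, adm rho).
  by apply: le_trans (warped_dist_ge x y hr); case: hr => -[].
by rewrite warped_dist_noadm.
Qed.

Lemma warped_dist_refl x : wd x x = 0.
Proof.
apply/eqP; rewrite eq_le warped_dist_ge0 andbT.
by have := warped_dist_chain_le (Wchain_nil x); rewrite mulr0 addr0.
Qed.

Lemma warped_dist_sym x y : wd x y = wd y x.
Proof.
congr sup; apply/seteqP; split=> _ [rho hr <-]; exists rho => //;
  by case: hr => -[].
Qed.

Lemma warped_dist_triangle x y z : wd x z <= wd x y + wd y z.
Proof.
have [[rho hr]|h] := pselect (exists rho, adm rho); last first.
  by rewrite !warped_dist_noadm ?addr0.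
apply: ge_sup; first by exists (rho x z), rho.
move=> _ [r' hr' <-].
apply: (@le_trans _ _ (r' x y + r' y z)); first by case: hr' => -[].
by rewrite lerD ?warped_dist_ge.
Qed.

(** The infimum [D] of the costs of chains is itself an admissible metric, hence at most the
    supremum. The given admissible metric is used to see that [D] separates points. *)
Lemma warped_dist_chain x y s : (exists rho, adm rho) -> wd x y < s ->
  exists k l, wchain x y k l /\ k%:R + t * l < s.
Proof.
move=> [rho hr] xys.
pose C u v : set R := [set a | exists k l, wchain u v k l /\ a = k%:R + t * l].
pose D u v := inf (C u v).
have Cn u v : C u v !=set0.
  by exists (0%:R + t * d u v), 0%N, (d u v); split=> //; exact: wchain_move1.
have C0 u v a : C u v a -> 0 <= a.
  by move=> [k [l [h ->]]]; rewrite addr_ge0 ?mulr_ge0 ?(wchain_ge0 h).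
have Dle u v k l : wchain u v k l -> D u v <= k%:R + t * l.
  move=> h; apply: ge_inf; last by exists k, l.
  by exists 0 => a /C0.
have Dge u v b : (forall k l, wchain u v k l -> b <= k%:R + t * l) -> b <= D u v.
  move=> h; apply: lb_le_inf => // _ [k [l [h1 ->]]]; exact: h.
have Dge0 u v : 0 <= D u v by apply: lb_le_inf => // a /C0.
have Dxx u : D u u = 0.
  apply/eqP; rewrite eq_le Dge0 andbT.
  by have := Dle _ _ _ _ (Wchain_nil u); rewrite mulr0 addr0.
have hD : adm D.
  split; last 1 first.
  - move=> s' y' Ss; have := Dle _ _ _ _ (wchain_jump1 y' Ss).
    by rewrite mulr0 addr0.
  - split=> //.
    + move=> u v; split=> [uv|->//]; case: (hr) => -[r0 rxx _ _] _ _.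
      apply/rxx/eqP; rewrite eq_le r0 andbT -uv; apply: Dge => k l.
      exact: admissible_chain.
    + by move=> u v; apply/eqP; rewrite eq_le; apply/andP; split;
        apply: Dge => k l /wchain_rev; exact: Dle.
    + move=> u v w; rewrite -lerBlDr; apply: (Dge _ _ _) => k l h.
      rewrite lerBlDr addrC -lerBlDr; apply: Dge => k' l' h'.
      rewrite lerBlDr; apply: le_trans (Dle _ _ _ _ (wchain_cat h h')) _.
      by rewrite natrD mulrDr addrACA addrC.
  - by move=> u v; have := Dle _ _ _ _ (wchain_move1 u v); rewrite add0r.
have [] := inf_lt (Cn x y) (le_lt_trans (warped_dist_ge x y hD) xys).
by move=> _ [k [l [h ->]]] lt; exists k, l.
Qed.

End WarpedChains.

(** * Transport along coarse equivalences *)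

Section CoarseTransfer.
Variables (R : realType) (X Y : Type) (dX : X -> X -> R) (dY : Y -> Y -> R).
Variables (f : X -> Y) (A : R).
Hypothesis dXxx : forall x, dX x x = 0.
Hypothesis dXC : forall x y, dX x y = dX y x.
Hypothesis dXt : forall x y z, dX x z <= dX x y + dX y z.
Hypothesis dYxx : forall x, dY x x = 0.
Hypothesis dYC : forall x y, dY x y = dY y x.
Hypothesis dYt : forall x y z, dY x z <= dY x y + dY y z.
Hypothesis A0 : 0 <= A.

(** The extra 1 allows for an infimum that is not attained. *)
Lemma coarsely_dense :
  (forall y, (ereal_inf [set (dY y (f x))%:E | x in [set: X]] <= A%:E)%E) ->
  exists h : Y -> X, forall y, dY y (f (h y)) <= A + 1.
Proof.
move=> dense.
have /choice[h hh] : forall y, exists x, dY y (f x) <= A + 1; last by exists h.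
move=> y; have : (ereal_inf [set (dY y (f x))%:E | x in [set: X]] < (A + 1)%:E)%E.
  by apply: le_lt_trans (dense y) _; rewrite lte_fin ltrDl.
by move=> /ereal_inf_lt[_ [x _ <-]]; rewrite lte_fin => /ltW; exists x.
Qed.

(** The cocycle is pulled back along the quasi-inverse [h], trivialised on [Y], and the primitive is
    corrected by the jumps from [x] to [h (f x)]. In the bound on [r], the first summand controls
    [h] on points [2 * rho] apart (the free third side), the second controls [h] on the images of
    adjacent points, and 1 is the length of an edge. *)
Lemma quasi_isometry_coboundary (L rho r : R) (h : Y -> X) (K : groupType)
    (c : X -> X -> K) :
  1 <= L -> 0 <= rho ->
  (forall x x', Num.max 0 (L^-1 * dX x x' - A) <= dY (f x) (f x') <= L * dX x x' + A) ->
  (forall y, dY y (f (h y)) <= A + 1) ->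
  L * (2 * rho + 3 * A + 2) + L * (L + 4 * A + 2) + 1 <= r ->
  (forall b : Y -> Y -> K, cocycle dY rho b -> coboundary dY (L + A) b) ->
  triangle_cocycle dX r c -> coboundary dX 1 c.
Proof.
move: (A0) => A_ge0 L1 rho0 qi dense hr triv cc.
have L0 : 0 < L by exact: lt_le_trans L1.
have low x x' : dX x x' <= L * (dY (f x) (f x') + A).
  have /andP[+ _] := qi x x'; rewrite ge_max => /andP[_].
  by rewrite lerBlDr ler_pdivrMl// [X in _ -> X]/=.
have hh z w : dX (h z) (h w) <= L * (dY z w + 3 * A + 2).
  apply: le_trans (low _ _) _; rewrite ler_pM2l//.
  have := dYt (f (h z)) z (f (h w)); have := dYt z w (f (h w)).
  have := dense z; have := dense w; rewrite (dYC z (f (h z))); lra.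
have hf x : dX x (h (f x)) <= L * (2 * A + 1).
  by apply: le_trans (low _ _) _; rewrite ler_pM2l//; have := dense (f x); lra.
have P1 : 0 <= L * (2 * rho + 3 * A + 2) by rewrite mulr_ge0 ?ltW//; lra.
have P2 : 0 <= L * (L + 4 * A + 2) by rewrite mulr_ge0 ?ltW//; lra.
have r0 : 0 <= r by lra.
have P3 : L * (2 * A + 1) + 1 <= r.
  apply: le_trans hr; have : L * (2 * A + 1) <= L * (L + 4 * A + 2).
    by rewrite ler_pM2l//; lra.
  lra.
pose b z w := c (h z) (h w).
have bc : cocycle dY rho b.
  have le1 z w : dY z w <= 2 * rho -> dX (h z) (h w) <= r.
    move=> zw; apply: le_trans (hh z w) _; apply: le_trans hr.
    have : L * (dY z w + 3 * A + 2) <= L * (2 * rho + 3 * A + 2).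
      by rewrite ler_pM2l//; lra.
    lra.
  move=> x y z xy yz; apply: cc; apply: le1; try lra.
  by have := dYt x y z; lra.
have [phi hphi] := triv b bc.
have csym x y : dX x y <= r -> c y x = ((c x y)^-1)%g.
  move=> xy; have c1 : c x x = 1%g.
    by apply: (@mulgI _ (c x x)); rewrite mulg1 cc ?dXxx.
  by apply: (@mulgI _ (c x y)); rewrite mulgV cc ?dXxx// dXC.
exists (fun x => phi (f x) * (c x (h (f x)))^-1)%g => x y xy.
have hx := hf x; have hy := hf y.
have fxy : dY (f x) (f y) <= L + A.
  have /andP[_ h2] := qi x y; apply: le_trans h2 _; rewrite lerD2r.
  by rewrite -[leRHS]mulr1 ler_pM2l.
have hfxy : dX (h (f x)) (h (f y)) <= r.
  apply: le_trans (hh _ _) _; apply: le_trans hr.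
  have : L * (dY (f x) (f y) + 3 * A + 2) <= L * (L + 4 * A + 2).
    by rewrite ler_pM2l//; lra.
  lra.
have Q1 : dX x (h (f y)) <= r by have := dXt x y (h (f y)); lra.
rewrite -(cc x (h (f y)) y); [|by []|by rewrite dXC; lra|lra].
rewrite -(cc x (h (f x)) (h (f y))); [|lra|by []|by []].
rewrite -/(b (f x) (f y)) hphi// (csym y (h (f y))); last lra.
by rewrite invgM invgK !mulgA.
Qed.

(** The reverse transport, with the cocycle pulled back along [f]. Points at distance 1 in [Y] have
    approximants in the image at distance at most [2 * (A + 1) + 1], and [2 * A + 3 < eta r] brings
    their preimages within [r]. *)
Lemma coarse_coboundary (eta zeta : R -> R) (rho r : R) (h : Y -> X)
    (K : groupType) (c : Y -> Y -> K) (x0 : X) :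
  (forall s s', 0 <= s -> s <= s' -> eta s <= eta s' /\ zeta s <= zeta s') ->
  (forall x y, 0 <= dX x y) ->
  (forall x x', eta (dX x x') <= dY (f x) (f x') <= zeta (dX x x')) ->
  (forall y, dY y (f (h y)) <= A + 1) ->
  0 <= r -> 2 * A + 3 < eta r -> zeta r <= rho -> 2 * A + 3 <= rho ->
  (forall x, exists l, path (fun u v => dX u v <= r) x0 l /\ last x0 l = x) ->
  pi1r_vanishes dX r x0 ->
  cocycle dY rho c -> coboundary dY 1 c.
Proof.
move: (A0) => A_ge0 mono dX0 co dense r0 er zr rho1 conn van cc.
have bc : cocycle dX r (fun x y => c (f x) (f y)).
  have le1 x y : dX x y <= r -> dY (f x) (f y) <= rho.
    move=> xy; have /andP[_ h2] := co x y; apply: le_trans h2 _.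
    by apply: le_trans zr; exact: (mono _ _ _ xy).2.
  by move=> x y z xy yz; apply: cc; exact: le1.
have [phi hphi] := pi1r_vanishes_cocycle r0 dXxx dXC bc conn van.
have rho0 : 0 <= rho by lra.
exists (fun y => phi (h y) * (c y (f (h y)))^-1)%g => z w zw.
have hz := dense z; have hw := dense w.
have t1 := dYt (f (h z)) z (f (h w)); have t2 := dYt z w (f (h w)).
rewrite (dYC (f (h z)) z) in t1.
have hzw : dX (h z) (h w) <= r.
  rewrite leNgt; apply/negP => lt.
  have /andP[h1 _] := co (h z) (h w).
  have := (mono _ _ r0 (ltW lt)).1; lra.
rewrite -(cc z (f (h w)) w); [|lra|rewrite dYC; lra].
rewrite -(cc z (f (h z)) (f (h w))); [|lra|lra].
rewrite hphi// [c (f (h w)) w](cocycle_sym rho0 dYxx dYC cc); last lra.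
by rewrite invgM invgK !mulgA.
Qed.

End CoarseTransfer.

(** * Word balls *)

Section WordBall.
Variables (G : groupType) (S : set G).
Local Open Scope group_scope.

Lemma word_ballM k k' w w' : word_ball S k w -> word_ball S k' w' ->
  word_ball S (k + k') (w * w').
Proof.
move=> [l [h1 h2 ->]] [l' [h1' h2' ->]]; exists (l ++ l'); split.
- by rewrite size_cat leq_add.
- by move=> s; rewrite mem_cat => /orP[/h2|/h2'].
- by rewrite big_cat.
Qed.

Lemma word_ballV k w : word_ball S k w -> word_ball S k w^-1.
Proof.
move=> [l [h1 h2 ->]]; exists (rev (map (fun s => s^-1) l)); split.
- by rewrite size_rev size_map.
- move=> s; rewrite mem_rev => /mapP[u /h2 h ->]; rewrite invgK.
  by case: h; [right|left].
- by rewrite -map_rev big_map prodgV revK.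
Qed.

Lemma word_ball_le k k' w : (k <= k')%N -> word_ball S k w -> word_ball S k' w.
Proof. by move=> kk [l [h1 h2 ->]]; exists l; split=> //; exact: leq_trans kk. Qed.

Lemma word_ball1 k : word_ball S k 1.
Proof. by exists [::]; split=> //; rewrite big_nil. Qed.

Lemma word_ball_gen s : S s \/ S s^-1 -> word_ball S 1 s.
Proof. by move=> h; exists [:: s]; split=> [//|u|]; rewrite ?big_seq1// inE => /eqP ->. Qed.

Lemma finite_word_bound : generates S -> finite_set [set: G] ->
  exists k, forall g, word_ball S k g.
Proof.
move=> /choice[f hf] /finite_seqP[s hs].
exists (\max_(g <- s) f g)%N => g; apply: word_ball_le (hf g).
have gs : g \in s by have : [set: G] g by []; rewrite hs.
by rewrite (big_rem g)//= leq_maxl.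
Qed.

End WordBall.

(** * Box spaces *)

Section CayleyQuotient.
Variables (R : realType) (G : groupType) (S : set G) (N : set G).
Hypothesis normN : normal_subgroup N.
Hypothesis genS : generates S.
Local Open Scope group_scope.

Definition coset_class (g : G) : Defs.quotient_group N :=
  exist _ (coset_set N g) (ex_intro _ g erefl).

Lemma quotient_group_inj : injective (@sval _ _ : Defs.quotient_group N -> set G).
Proof.
by case=> C hC [D hD] /= e; subst D; congr exist; exact: Prop_irrelevance.
Qed.

Lemma coset_class_surj (C : Defs.quotient_group N) : exists g, C = coset_class g.
Proof.
by case: C => C [g e]; exists g; exact: quotient_group_inj.
Qed.

Lemma coset_set_eq g h : coset_set N g = coset_set N h <-> N (g^-1 * h).
Proof.
have [N1 NM NV _] := normN; split=> [e|gh].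
  have : coset_set N h h by exists 1; rewrite ?mulg1.
  by rewrite -e => -[x Nx <-]; rewrite mulKg.
apply/seteqP; split=> _ [x Nx <-].
  exists ((g^-1 * h)^-1 * x); first by apply: NM => //; exact: NV.
  by rewrite invgM invgK !mulgA mulgV mul1g.
by exists (g^-1 * h * x); [exact: NM|rewrite -!mulgA mulKVg].
Qed.

Lemma coset_class_eq g h : coset_class g = coset_class h <-> N (g^-1 * h).
Proof.
rewrite -coset_set_eq; split=> [/(congr1 sval)//|e].
exact: quotient_group_inj.
Qed.

(** Normality makes right multiplication well defined on the left cosets. *)
Lemma coset_classMr g h s : coset_class g = coset_class h ->
  coset_class (g * s) = coset_class (h * s).
Proof.
move=> /coset_class_eq gh; apply/coset_class_eq.
have [_ _ _ NJ] := normN; have := NJ _ s gh.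
by rewrite conjgE invgM -!mulgA.
Qed.

Lemma cayley_quotientP C D : cayley_quotient S C D <->
  exists g s, [/\ S s \/ S s^-1, C = coset_class g & D = coset_class (g * s)].
Proof.
split=> [[g [s [h1 h2 h3]]]|[g [s [h1 -> ->]]]]; last by exists g, s.
exists g, s; have [g1 e1] := coset_class_surj C; have [g2 e2] := coset_class_surj D.
split=> //; rewrite ?e1 ?e2; apply/coset_class_eq/coset_set_eq.
  by rewrite -h2 e1.
by rewrite -h3 e2.
Qed.

Local Notation cay := (@cayley_quotient G S N).
Local Notation cayb := (fun u v => `[< cay u v >]).

Lemma cayley_sym C D : cay C D -> cay D C.
Proof.
move=> /cayley_quotientP[g [s [h -> ->]]]; apply/cayley_quotientP.
exists (g * s), s^-1; rewrite mulgK; split=> //.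
by rewrite invgK; case: h; [right|left].
Qed.

Lemma cayley_word_path k w : word_ball S k w -> forall g, exists p,
  [/\ path cayb (coset_class g) p, last (coset_class g) p = coset_class (g * w)
    & (size p <= k)%N].
Proof.
move=> [l [hl hS ->]] g; elim: l k g hl hS => [|s l ih] k g hl hS.
  by exists [::]; rewrite big_nil mulg1.
case: k hl => // k hl.
have [|p [p1 p2 p3]] := ih k (g * s) hl.
  by move=> u ul; apply: hS; rewrite inE ul orbT.
exists (coset_class (g * s) :: p); split=> //=.
  rewrite p1 andbT; apply/asboolP/cayley_quotientP; exists g, s; split=> //.
  by apply: hS; rewrite inE eqxx.
by rewrite p2 big_cons mulgA.
Qed.

Lemma cayley_path_word g p : path cayb (coset_class g) p -> exists w,
  word_ball S (size p) w /\ last (coset_class g) p = coset_class (g * w).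
Proof.
elim: p g => [|D p ih] g /=.
  by exists 1; rewrite mulg1; split=> //; exact: word_ball1.
move=> /andP[/asboolP /cayley_quotientP[g' [s [hs /esym e1 ->]]]].
rewrite (coset_classMr s e1) => /ih[w [hw ->]]; exists (s * w).
rewrite mulgA; split=> //; rewrite -add1n; apply: word_ballM hw.
exact: word_ball_gen.
Qed.

Lemma cayley_conn C D : exists p, path cayb C p /\ last C p = D.
Proof.
have [g ->] := coset_class_surj C; have [h ->] := coset_class_surj D.
have [k /cayley_word_path/(_ g)[p [h1 h2 _]]] := genS (g^-1 * h).
by exists p; rewrite h1 h2 mulKVg.
Qed.

Local Notation gd := (graph_dist R cay).

Lemma cayley_dist_le g w k : word_ball S k w ->
  (gd (coset_class g) (coset_class (g * w)) <= k%:R)%R.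
Proof.
move=> /cayley_word_path/(_ g)[p [h1 <- h3]].
by apply: le_trans (graph_dist_le R h1) _; rewrite ler_nat.
Qed.

Lemma cayley_dist_word g D k : (gd (coset_class g) D <= k%:R)%R ->
  exists w, word_ball S k w /\ D = coset_class (g * w).
Proof.
have [p [h1 <- <-]] := graph_dist_geodesic R cayley_conn (coset_class g) D.
rewrite ler_nat => h; have [w [h2 ->]] := cayley_path_word h1.
by exists w; split=> //; exact: word_ball_le h h2.
Qed.

(** The radius is [2 k] so that a product of two lifts of length [k] is still a lift; two lifts of
    one pair then differ by an element of [N] of length at most [4 k]. *)
Definition short_lift k (C D : Defs.quotient_group N) : set G :=
  [set w | word_ball S (k + k) w /\
     exists g, C = coset_class g /\ D = coset_class (g * w)].

Lemma short_lift_unique k C D v w :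
  (forall x, N x -> word_ball S (k + k + (k + k)) x -> x = 1) ->
  short_lift k C D v -> short_lift k C D w -> v = w.
Proof.
move=> Nk [hv [g [-> ->]]] [hw [h [e1 e2]]].
have e3 := coset_classMr w e1; rewrite -e2 in e3.
move/coset_class_eq: e3; rewrite invgM -mulgA mulKg => Nvw.
have /(Nk _ Nvw) e : word_ball S (k + k + (k + k)) (w^-1 * v).
  by apply: word_ballM => //; exact: word_ballV.
by rewrite -[w]mulg1 -e mulVKg.
Qed.

Lemma short_lift_cocycle k : (forall x, N x -> word_ball S (k + k + (k + k)) x -> x = 1) ->
  (0 < k)%N ->
  exists c : Defs.quotient_group N -> Defs.quotient_group N -> G,
    cocycle gd k%:R c /\
    forall g s, S s \/ S s^-1 -> c (coset_class g) (coset_class (g * s)) = s.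
Proof.
move=> Nk k0; pose c C D := xget 1 (short_lift k C D).
have cE C D w : short_lift k C D w -> c C D = w.
  move=> h; have h' : short_lift k C D (c C D) by apply: xgetPex; exists w.
  exact: short_lift_unique Nk h' h.
exists c; split.
  move=> C D E; have [g ->] := coset_class_surj C.
  move=> /cayley_dist_word[v [hv ->]] /cayley_dist_word[w [hw ->]].
  have lift g' u : word_ball S k u -> short_lift k (coset_class g') (coset_class (g' * u)) u.
    move=> hu; split; last by exists g'.
    by apply: word_ball_le hu; exact: leq_addr.
  rewrite (cE _ _ _ (lift g v hv)) (cE _ _ _ (lift (g * v) w hw)).
  apply/esym/cE; split; first exact: word_ballM.
  by exists g; rewrite mulgA.
move=> g s hs; apply: cE; split; last by exists g.
by apply: word_ball_le (word_ball_gen hs); rewrite (leq_trans k0)// leq_addr.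
Qed.

(** Telescoping along a word [w] gives [phi(g)^-1 phi(g w) = w]; for [w] in [N] both cosets
    coincide. *)
Lemma short_lift_coboundary (c : Defs.quotient_group N -> Defs.quotient_group N -> G) :
  (forall g s, S s \/ S s^-1 -> c (coset_class g) (coset_class (g * s)) = s) ->
  coboundary gd 1 c -> forall x, N x -> x = 1.
Proof.
move=> cs [phi hphi] x Nx.
have key k w : word_ball S k w -> forall g,
    (phi (coset_class g))^-1 * phi (coset_class (g * w)) = w.
  move=> [l [_ hl ->]]; elim: l hl => [|s l ih] hl g.
    by rewrite big_nil mulg1 mulVg.
  have hs : S s \/ S s^-1 by apply: hl; rewrite inE eqxx.
  rewrite big_cons mulgA -{2}(cs g s hs) hphi; last first.
    exact: (@cayley_dist_le g s 1 (word_ball_gen hs)).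
  rewrite -[in RHS](ih _ (g * s)); last by move=> u ul; apply: hl; rewrite inE ul orbT.
  by rewrite -[RHS]mulgA mulKVg.
have [k hk] := genS x.
rewrite -(key k x hk 1); have -> : coset_class (1 * x) = coset_class 1.
  have [_ _ NV _] := normN.
  by apply/coset_class_eq; rewrite mul1g mulg1; exact: NV.
by rewrite mulVg.
Qed.

End CayleyQuotient.

(** * Consequences of a coarse equivalence with an expander *)

Section ExpanderCoarse.
Variables (R : realType) (V : nat -> finType) (e : forall n, rel (V n)).
Hypothesis hexp : expander R e.
Variables (Y : nat -> Type) (dY : forall n, Y n -> Y n -> R).
Arguments dY {n}.
Hypothesis dYxx : forall n (x : Y n), dY x x = 0.
Hypothesis dYC : forall n (x y : Y n), dY x y = dY y x.
Hypothesis dYt : forall n (x y z : Y n), dY x z <= dY x y + dY y z.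
Local Notation gd n := (graph_dist R (@e n)).

Lemma expander_sym n (x y : V n) : e x y -> e y x.
Proof. by case: hexp => /(_ n)[h _] _ _ _; rewrite h. Qed.

Lemma expander_conn n (x y : V n) : exists p,
  path (fun u v => `[< e u v >]) x p /\ last x p = y.
Proof.
case: hexp => /(_ n)[h _] _ _ [c c0 /(_ n) hc].
exact: cheeger_connected h _ c0 hc x y.
Qed.

Lemma expander_large m : exists n0, forall n, (n0 <= n)%N -> (m <= #|V n|)%N.
Proof.
by case: hexp => _ /cvgnyPge /(_ m) [n0 _ h] _ _; exists n0 => n; exact: h.
Qed.

Lemma eta_large (eta : R -> R) M : eta s @[s --> +oo] --> +oo ->
  exists s, forall s', s < s' -> M <= eta s'.
Proof. by move=> /cvgryPge /(_ M) [s [_ h]]; exists s. Qed.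

Lemma coarsely_equivalent_coboundary :
  (exists (r0 : R) (n0 : nat), 0 < r0 /\
     forall (r : R) (n : nat), r0 <= r -> (n0 <= n)%N ->
     forall x : V n, pi1r_vanishes (gd n) r x) ->
  coarsely_equivalent (fun n => gd n) (@dY) ->
  exists (rho : R) (n0 : nat), forall n, (n0 <= n)%N ->
    inhabited (Y n) /\
    forall (K : groupType) (c : Y n -> Y n -> K),
      cocycle dY rho c -> coboundary dY 1 c.
Proof.
move=> [r0 [n0 [r00 van]]] [eta [zeta [A [pos mono etaoo A0 [f hf]]]]].
have [s hs] := eta_large (2 * A + 4) etaoo.
(* Beyond [s] the function [eta] is at least [2 * A + 4]; beyond [r0] the fundamental groups vanish;
   and scale 1 makes edges admissible steps. *)
pose r := Num.max (s + 1) (Num.max r0 1).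
have [r1 r2 r3] : [/\ s < r, r0 <= r & 1 <= r].
  by rewrite /r !le_max !lt_max ltrDl ltr01 !lexx !orbT.
have [n1 hn1] := expander_large 1.
exists (Num.max (zeta r) (2 * A + 3)), (maxn n0 n1) => n.
rewrite geq_max => /andP[h0 h1].
have /card_gt0P[x0 _] := hn1 n h1.
split=> [|K c hc]; first exact: inhabits (f n x0).
have [h hh] := coarsely_dense (fun y => (hf n).2 y).
have vn := van r n r2 h0 x0.
have ec := @expander_conn n.
have es := @expander_sym n.
have co := (fun x x' => (hf n).1 x x').
apply: (@coarse_coboundary _ _ _ (gd n) (@dY n) (f n) A _ _ _ _ _ A0 eta zeta _ r h K c x0 mono _ co hh _ _ _ _ _ vn hc) => //.
- exact: graph_dist_refl.
- exact: graph_dist_sym.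
- exact: graph_dist_ge0.
- exact: le_trans r3.
- by apply: lt_le_trans (hs r r1); rewrite ltrD2l ltr_nat.
- by rewrite le_max lexx.
- by rewrite le_max lexx orbT.
- exact: graph_dist_conn.
Qed.

(** With bounded degrees and growing vertex sets, the diameters of the graphs are unbounded; [eta]
    transfers this to [Y]. *)
Lemma coarsely_equivalent_unbounded M :
  coarsely_equivalent (fun n => gd n) (@dY) ->
  exists n (y y' : Y n), M < dY y y'.
Proof.
move=> [eta [zeta [A [pos mono etaoo A0 [f hf]]]]].
have [s hs] := eta_large (M + 1) etaoo.
have [_ _ [D hD] _] := hexp.
have [k hk] : exists k : nat, s < k%:R by exists (Num.truncn s).+1; rewrite truncnS_gt.
have [n1 hn1] := expander_large (D.+1 ^ k).+1.
have /card_gt0P[x0 _] : (0 < #|V n1|)%N by apply: leq_trans (hn1 n1 (leqnn _)).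
have : ~ forall y, exists p,
   [/\ path (fun u v => `[< e u v >]) x0 p, last x0 p = y & (size p <= k)%N].
  move=> h; have := hn1 n1 (leqnn _).
  by rewrite ltnNge (card_le_ball (hD n1) h).
move=> /existsNP[y hy]; exists n1, (f n1 x0), (f n1 y).
have [p [p1 p2 p3]] := graph_dist_geodesic R (@expander_conn n1) x0 y.
have hp : s < gd n1 x0 y.
  apply: lt_trans hk _; rewrite -p3 ltr_nat ltnNge; apply/negP => pk.
  by apply: hy; exists p.
have /andP[+ _] := (hf n1).1 x0 y; apply: lt_le_trans.
by apply: lt_le_trans (hs _ hp); rewrite ltrDl.
Qed.

End ExpanderCoarse.

(** Trivialising the lifting cocycle for one large [n] makes [N n] trivial. Then [G] is finite and
    all its quotients have uniformly bounded diameter, unlike the expander. *)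
Lemma not_coarsely_equivalent_box_space (R : realType) (V : nat -> finType)
    (e : forall n, rel (V n)) (G : groupType) (S : set G) (N : nat -> set G) :
  expander R e ->
  (exists (r0 : R) (n0 : nat), 0 < r0 /\
     forall (r : R) (n : nat), r0 <= r -> (n0 <= n)%N ->
     forall x : V n, pi1r_vanishes (graph_dist R (@e n)) r x) ->
  generates S -> box_filtration S N ->
  ~ coarsely_equivalent (fun n => graph_dist R (@e n))
      (fun n => graph_dist R (@cayley_quotient G S (N n))).
Proof.
move=> hexp van genS [normN filtN] coarse.
have conn n := cayley_conn (normN n).1 genS.
have sym n := @cayley_sym G S (N n) (normN n).1.
have [rho [n0 triv]] := coarsely_equivalent_coboundary hexp
  (fun n => graph_dist_refl R (@conn n)) (fun n => graph_dist_sym R (@sym n) (@conn n))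
  (fun n => graph_dist_triangle R (@conn n)) van coarse.
pose k := (Num.truncn rho).+1.
have rk : rho <= k%:R by rewrite ltW// truncnS_gt.
have [n1 hn1] := filtN (k + k + (k + k))%N.
pose n := maxn n0 n1.
have N1 x : N n x -> x = 1%g.
  have [_ triv'] := triv n (leq_maxl _ _).
  have short y : N n y -> word_ball S (k + k + (k + k)) y -> y = 1%g.
    move=> Ny wy; have : [set 1%g : G] y by rewrite -hn1; split=> //; exists n; rewrite //= leq_maxr.
    by [].
  have [c [cc cs]] := short_lift_cocycle R (normN n).1 genS short isT.
  apply: (short_lift_coboundary (normN n).1 genS cs); apply: triv'.
  by move=> C D E h1 h2; apply: cc; exact: le_trans rk.
(* As [N n] is trivial, an element is recovered from its coset, and there are finitely many
   cosets. *)
have finG : finite_set [set: G].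
  have [nN finN] := normN n.
  pose pick C := xget 1%g [set g | C = coset_set (N n) g].
  apply: (@sub_finite_set _ _ (pick @` [set coset_set (N n) g | g in [set: G]])); last first.
    exact: finite_image.
  move=> g _; exists (coset_set (N n) g); first by exists g.
  have : coset_set (N n) g = coset_set (N n) (pick (coset_set (N n) g)).
    exact: (@xgetPex _ 1%g [set h | coset_set (N n) g = coset_set (N n) h] (ex_intro _ g erefl)).
  move=> /(coset_set_eq nN _ _).1 /N1 gp.
  by rewrite -[LHS](mulKVg g) gp mulg1.
have [m hm] := finite_word_bound genS finG.
have [n' [C [D]]] := coarsely_equivalent_unbounded hexp m%:R coarse.
have [g ->] := coset_class_surj C; have [h ->] := coset_class_surj D.
have := cayley_dist_le R (normN n').1 g (hm (g^-1 * h)%g).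
by rewrite mulKVg => /le_lt_trans/[apply]; rewrite ltxx.
Qed.

(** * Planar developments and strips *)

Section PlanarDevelopment.
Variable R : realType.
Implicit Types p q : R * R.

Definition rect (B : R) p : bool := (0 <= p.1 <= B) && (0 <= p.2 <= 1).

Definition close_pt (delta : R) p q : bool :=
  (`|p.1 - q.1| <= delta) && (`|p.2 - q.2| <= delta).

Definition scale_pt (s : R) p : R * R := (s * p.1, s * p.2).

Definition shift_pt p : R * R := (p.1 + 1, p.2).

Definition shear_pt p : R * R := (p.1 + 2 * p.2, p.2).

Lemma rectW B B' p : B <= B' -> rect B p -> rect B' p.
Proof.
by move=> BB /andP[/andP[h1 h2] h3]; rewrite /rect h1 h3 (le_trans h2 BB).
Qed.

Lemma rect_scale B s p : 0 <= s <= 1 -> rect B p -> rect B (scale_pt s p).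
Proof.
case: p => x y /andP[s0 s1] /andP[/andP[/= x0 xB] /andP[/= y0 y1]].
rewrite /rect /= !mulr_ge0//=; apply/andP; split.
  by apply: le_trans xB; rewrite ler_piMl.
by apply: le_trans y1; rewrite ler_piMl.
Qed.

Lemma close_pt_sym delta p q : close_pt delta p q = close_pt delta q p.
Proof. by rewrite /close_pt !(distrC q.1) (distrC q.2). Qed.

Lemma close_pt_scale delta s p q : 0 <= s <= 1 -> close_pt delta p q ->
  close_pt delta (scale_pt s p) (scale_pt s q).
Proof.
case: p q => x y [x' y'] /andP[s0 s1] /andP[/= h1 h2].
rewrite /close_pt /= -!mulrBr !normrM !(ger0_norm s0).
by apply/andP; split; [apply: le_trans h1|apply: le_trans h2]; rewrite ler_piMl.
Qed.

Lemma subdivision B delta : 1 <= B -> 0 < delta -> exists N, (0 < N)%N /\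
  forall p j, rect B p -> (j < N)%N ->
  close_pt delta (scale_pt (j%:R / N%:R) p) (scale_pt (j.+1%:R / N%:R) p).
Proof.
move=> B1 d0; pose N := (Num.truncn (B / delta)).+1; exists N; split=> //.
have N0 : 0 < N%:R :> R by rewrite ltr0n.
have BN : B / N%:R <= delta.
  rewrite ler_pdivrMr// mulrC -ler_pdivrMr//; exact/ltW/truncnS_gt.
move=> [x y] j /andP[/andP[/= x0 xB] /andP[/= y0 y1]] jN.
have st a : 0 <= a <= B -> `|j%:R / N%:R * a - j.+1%:R / N%:R * a| <= delta.
  move=> /andP[a0 aB]; rewrite -mulrBl -mulrBl -natr1 opprD addNKr.
  rewrite normrM normrM normrN1 mul1r normfV (ger0_norm a0) normr_nat.
  by apply: le_trans BN; rewrite mulrC ler_pM2r// invr_gt0.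
by rewrite /close_pt /= !st ?x0 ?y0//= (le_trans y1).
Qed.

Lemma frac_itv (j N : nat) : (0 < N)%N -> (j <= N)%N ->
  0 <= (j%:R / N%:R : R) <= 1.
Proof.
move=> N0 jN; rewrite divr_ge0//= ler_pdivrMr ?ltr0n//.
by rewrite mul1r ler_nat.
Qed.

Lemma scale_pt0 p : scale_pt 0 p = (0, 0).
Proof. by rewrite /scale_pt !mul0r. Qed.

Lemma scale_pt1 p : scale_pt 1 p = p.
Proof. by case: p => x y; rewrite /scale_pt !mul1r. Qed.

Lemma rect00 B : 0 <= B -> rect B (0, 0).
Proof. by move=> B0; rewrite /rect /= lexx B0 ler01. Qed.

(** The rectangle is star-shaped about the origin: walk to [p] along the segment in steps of size at
    most [delta]. *)
Lemma locally_constant (T : Type) (w : R * R -> T) B delta : 1 <= B ->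
  0 < delta ->
  (forall p q, rect B p -> rect B q -> close_pt delta p q -> w p = w q) ->
  forall p, rect B p -> w p = w (0, 0).
Proof.
move=> B1 d0 hw p hp; have [N [N0 hN]] := subdivision B1 d0.
suff h j : (j <= N)%N -> w (scale_pt (j%:R / N%:R) p) = w (0, 0).
  by have := h N (leqnn N); rewrite divff ?pnatr_eq0 -?lt0n// scale_pt1.
elim: j => [|j ih] jN; first by rewrite mul0r scale_pt0.
rewrite -ih ?(ltnW jN)//; apply/esym/hw; last exact: hN.
- by apply: rect_scale => //; apply: frac_itv => //; exact: ltnW.
- by apply: rect_scale => //; apply: frac_itv.
Qed.

Section Development.
Variables (K : groupType) (u : R * R -> R * R -> K) (B delta : R).
Hypothesis B1 : 1 <= B.
Hypothesis d0 : 0 < delta.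
Hypothesis hu : forall p q r, rect B p -> rect B q -> rect B r ->
  close_pt delta p q -> close_pt delta q r -> (u p q * u q r = u p r)%g.

(** [F p] is the product of [u] along the subdivided segment from the origin to [p]. The segments to
    two close points form a ladder with short rungs, and each of its cells commutes. *)
Lemma development : exists F : R * R -> K, forall p q, rect B p -> rect B q ->
  close_pt delta p q -> u p q = ((F p)^-1 * F q)%g.
Proof.
have [N [N0 hN]] := subdivision B1 d0.
pose ga p j : R * R := scale_pt (j%:R / N%:R) p.
pose P p := fix P j : K := if j is j'.+1 then (P j' * u (ga p j') (ga p j))%g else 1%g.
have rg p j : rect B p -> (j <= N)%N -> rect B (ga p j).
  by move=> hp jN; apply: rect_scale => //; exact: frac_itv.
have cxx p : close_pt delta p p by rewrite /close_pt !subrr normr0 ltW.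
have gN p : ga p N = p by rewrite /ga divff ?pnatr_eq0 -?lt0n// scale_pt1.
have key p q j : rect B p -> rect B q -> close_pt delta p q -> (j <= N)%N ->
    (P p j * u (ga p j) (ga q j) = P q j)%g.
  move=> hp hq pq; elim: j => [|j ih] jN /=.
    rewrite mul1g /ga mul0r !scale_pt0.
    by apply: (@mulgI _ (u (0, 0) (0, 0))); rewrite mulg1 hu// rect00// (le_trans _ B1).
  have jN' := ltnW jN.
  rewrite -(ih jN') -!mulgA; congr (_ * _)%g; rewrite !hu//; try exact: rg; try exact: hN;
    by apply: close_pt_scale => //; exact: frac_itv.
exists (P ^~ N) => p q hp hq pq.
by rewrite -(key p q N hp hq pq (leqnn N)) mulKg !gN.
Qed.

End Development.

Section Strip.
Variables (K : groupType) (X : Type) (c : X -> X -> K) (near : X -> X -> Prop).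
Variables (I : Type) (s : I -> I) (h : I -> R * R -> X) (a : X -> X) (delta : R).
Hypothesis near_refl : forall x, near x x.
Hypothesis cc : forall x y z, near x y -> near y z -> (c x y * c y z = c x z)%g.
Hypothesis sK : involutive s.
Hypothesis d0 : 0 < delta.
(** Length 3 is what the shear of the unit square occupies; the part of length 2 is what can still
    be shifted by one square. *)
Hypothesis h_near : forall i p q, rect 3 p -> rect 3 q -> close_pt delta p q ->
  near (h i p) (h i q).
Hypothesis h_shift : forall i p, rect 2 p -> h i (shift_pt p) = h (s i) p.
Hypothesis h_twist : forall i p, rect 1 p -> a (h i p) = h i (shear_pt p).
Hypothesis a_near : forall x, near x (a x).

Let c1 x : c x x = 1%g.
Proof. by apply: (@mulgI _ (c x x)); rewrite mulg1 cc. Qed.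

(* The shear fixes the points at height 0, translates those at height 1 by two
   squares, and those at height 1/2 by one square. Comparing the parallel transport
   along the strip with the jumps therefore kills the holonomy along two squares, and
   along one square when the strip closes up after a single square. *)
Lemma strip_holonomy : exists (F : I -> R * R -> K) (alpha : I -> K),
  [/\ forall i p q, rect 3 p -> rect 3 q -> close_pt delta p q ->
        c (h i p) (h i q) = ((F i p)^-1 * F i q)%g,
      forall i p, rect 2 p -> F i (shift_pt p) = (alpha i * F (s i) p)%g,
      forall i, (alpha i * alpha (s i) = 1)%g,
      forall i, s i = i -> alpha i = 1%g &
      forall i p, rect 1 p -> 
        c (h i p) (a (h i p)) = ((F i p)^-1 * F i (shear_pt p))%g].
Proof.
move: (d0) => delta0.
have n13 : 1 <= 3 :> R by lra.
have /choice[F hF] i : exists F : R * R -> K, forall p q, rect 3 p -> rect 3 q ->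
    close_pt delta p q -> c (h i p) (h i q) = ((F p)^-1 * F q)%g.
  apply: (@development K (fun p q => c (h i p) (h i q)) 3 delta) => // p q r hp hq hr pq qr.
  by apply: cc; exact: h_near.
(* The monodromy over one square, read at the origin; being locally constant in the point, it is the
   same everywhere. *)
pose alpha i := (F i (shift_pt (0, 0)) * (F (s i) (0, 0))^-1)%g.
have shift i p : rect 2 p -> F i (shift_pt p) = (alpha i * F (s i) p)%g.
  move=> hp.
  have : (F i (shift_pt p) * (F (s i) p)^-1 = alpha i)%g.
    apply: (@locally_constant _ (fun p => F i (shift_pt p) * (F (s i) p)^-1)%g 2 delta)
       => // [|{hp}p q hp hq pq]; first lra.
    have r3 q' : rect 2 q' -> rect 3 (shift_pt q').
      by case: q' => x y; rewrite /rect /shift_pt /= => /andP[/andP[? ?] ->]; rewrite andbT; lra.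
    have r3' q' : rect 2 q' -> rect 3 q' by apply: rectW; lra.
    have e1 : close_pt delta (shift_pt p) (shift_pt q).
      by move: pq; rewrite /close_pt /shift_pt /= opprD addrACA subrr addr0.
    have := hF i _ _ (r3 _ hp) (r3 _ hq) e1; rewrite !h_shift// hF ?r3'// => e2.
    apply: (@mulgI _ (F i (shift_pt p))^-1%g); rewrite mulKg mulgA -e2.
    by rewrite mulgK.
  by move=> <-; rewrite mulgVK.
have jump i p : rect 1 p ->
    c (h i p) (a (h i p)) = ((F i p)^-1 * F i (shear_pt p))%g.
  (* The discrepancy between the jump and the parallel transport along the strip; it is 1 at the
     origin, which the shear fixes. *)
  pose w p := (F i p * c (h i p) (a (h i p)) * (F i (shear_pt p))^-1)%g.
  move=> hp; suff : w p = 1%g.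
    rewrite /w => /divg1_eq <-; by rewrite mulKg.
  have -> : 1%g = w (0, 0).
    have r0 : rect 1 (0, 0) by rewrite rect00.
    by rewrite /w h_twist//= /shear_pt /= mulr0 addr0 c1 mulg1 mulgV.
  (* The shear enlarges coordinate differences by a factor of at most 3. *)
  apply: (@locally_constant _ w 1 (delta / 3)) => // [|{hp}p q hp hq pq].
    by rewrite divr_gt0.
  have r3' q' : rect 1 q' -> rect 3 q' by exact: rectW.
  have r3 q' : rect 1 q' -> rect 3 (shear_pt q').
    case: q' => x y; rewrite /rect /shear_pt /= => /andP[/andP[? ?] /andP[? ?]].
    by apply/andP; split; apply/andP; split; lra.
  have pq1 : close_pt delta p q.
    by move: pq => /andP[h1 h2]; rewrite /close_pt; apply/andP; split;
      [apply: le_trans h1 _|apply: le_trans h2 _]; lra.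
  have pq2 : close_pt delta (shear_pt p) (shear_pt q).
    case: p q pq {hp hq pq1} => x y [x' y'] /andP[/= h1 h2]; rewrite /close_pt /shear_pt /=.
    have e : x + 2 * y - (x' + 2 * y') = (x - x') + 2 * (y - y') by ring.
    rewrite e; apply/andP; split; last by apply: le_trans h2 _; lra.
    apply: le_trans (ler_normD _ _) _; rewrite normrM (ger0_norm (_ : 0 <= 2))//; lra.
  have e1 := cc (h_near i (r3' _ hp) (r3' _ hq) pq1) (a_near (h i q)).
  have n2 : near (a (h i p)) (a (h i q)).
    by rewrite !h_twist//; apply: h_near => //; exact: r3.
  have e2 := cc (a_near (h i p)) n2.
  have e3 : (c (a (h i p)) (a (h i q)) = (F i (shear_pt p))^-1 * F i (shear_pt q))%g.
    by rewrite !h_twist// hF// r3.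
  rewrite e3 -e1 hF ?r3'// in e2.
  rewrite /w; apply: (@mulgI _ (F i p)^-1%g); rewrite !mulgA mulVg mul1g.
  by apply: (@mulIg _ (F i (shear_pt q))); rewrite mulgVK -[LHS]mulgA e2.
exists F, alpha.
have twice i : (alpha i * alpha (s i) = 1)%g.
  have r1 : rect 1 (0, 1) by rewrite /rect /= !lexx ler01.
  have := jump i _ r1; rewrite h_twist//.
  have -> : shear_pt (0, 1) = (2, 1) by rewrite /shear_pt /= mulr1 add0r.
  have -> : h i (2, 1) = h i (0, 1).
    have -> : (2, 1) = shift_pt (1, 1) by congr pair => /=; ring.
    rewrite h_shift; last by rewrite /rect /=; lra.
    have -> : (1, 1) = shift_pt (0, 1) by congr pair => /=; ring.
    by rewrite h_shift ?sK// /rect /=; lra.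
  have -> : (2, 1) = shift_pt (1, 1) by congr pair => /=; ring.
  rewrite shift; last by rewrite /rect /=; lra.
  have -> : (1, 1) = shift_pt (0, 1) by congr pair => /=; ring.
  rewrite shift ?sK; last by rewrite /rect /=; lra.
  rewrite c1 => /esym e; apply: (@mulIg _ (F i (0, 1))).
  by rewrite mul1g -[RHS]mulg1 -e mulKVg -mulgA.
split=> // i si.
have r1 : rect 1 (0, 2^-1) by rewrite /rect /=; lra.
have := jump i _ r1; rewrite h_twist//.
have -> : shear_pt (0, 2^-1) = shift_pt (0, 2^-1).
  by rewrite /shear_pt /shift_pt /= divff// pnatr_eq0.
have r2 : rect 2 (0, 2^-1) by rewrite /rect /=; lra.
rewrite h_shift// shift// si c1 => /esym e; apply: (@mulIg _ (F i (0, 2^-1))).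
by rewrite mul1g -[RHS]mulg1 -e mulKVg.
Qed.

End Strip.
End PlanarDevelopment.

(** * The staircase *)

Section SquarePermutations.
Variable g : nat.
Hypothesis g1 : (1 < g)%N.
Local Notation squares := (squares g).

(** The product of the transpositions of [o + 2k] and [o + 2k + 1] for [k < n]. With squares
    numbered from 0, [sigma] has offset 0 and [tau] offset 1. *)
Definition line_swap (o n i : nat) : nat :=
  if (o <= i < o + n.*2)%N then (if odd (i - o) then i.-1 else i.+1) else i.

Lemma prod_tperm_val (o n : nat) : (o + n.*2 <= (g.-1.*2).+1)%N -> forall i : squares,
  val ((\prod_(k < n) tperm (inord (k.*2 + o)) (inord (k.*2 + o).+1) : {perm squares})%g i)
  = line_swap o n i.
Proof.
elim: n => [|n ih] hn i.
  by rewrite big_ord0 perm1 /line_swap double0 addn0; case: ifP => //; lia.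
rewrite big_ord_recr /= permM.
set j := (X in tperm _ _ X); have hj : val j = line_swap o n i by apply: ih; lia.
have hi := ltn_ord i.
have e1 : val (inord (n.*2 + o) : squares) = (n.*2 + o)%N by rewrite /= inordK//; lia.
have e2 : val (inord (n.*2 + o).+1 : squares) = (n.*2 + o).+1 by rewrite /= inordK//; lia.
rewrite permE /= -!val_eqE e1 e2 hj /line_swap.
case: (boolP (o <= i < o + n.*2)%N) => h.
  have -> : (o <= i < o + n.+1.*2)%N by lia.
  case: (boolP (odd (i - o))) => ho.
    have -> : (i.-1 == n.*2 + o)%N = false by lia.
    have -> : (i.-1 == (n.*2 + o).+1)%N = false by lia.
    by rewrite hj /line_swap h ho.
  have -> : (i.+1 == n.*2 + o)%N = false by lia.
  have -> : (i.+1 == (n.*2 + o).+1)%N = false by lia.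
  by rewrite hj /line_swap h (negbTE ho).
case: eqP => h1.
  have -> : (o <= i < o + n.+1.*2)%N by lia.
  have -> : odd (i - o) = false by lia.
  by rewrite e2; lia.
case: eqP => h2.
  have -> : (o <= i < o + n.+1.*2)%N by lia.
  have -> : odd (i - o) by lia.
  by rewrite e1; lia.
rewrite hj /line_swap (negbTE h).
by have -> : (o <= i < o + n.+1.*2)%N = false by lia.
Qed.

Lemma sigma_val (i : squares) : val (sigma g i) = line_swap 0 g.-1 i.
Proof.
rewrite -prod_tperm_val; last by lia.
congr (val (fun_of_perm _ _)); apply: eq_bigr => k _.
by rewrite addn0.
Qed.

Lemma tau_val (i : squares) : val (tau g i) = line_swap 1 g.-1 i.
Proof.
rewrite -prod_tperm_val; last by lia.
congr (val (fun_of_perm _ _)); apply: eq_bigr => k _.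
by rewrite addn1.
Qed.

Lemma line_swapK o n : involutive (line_swap o n).
Proof. by move=> i; rewrite /line_swap; repeat case: ifP; lia. Qed.

Lemma sigmaK : involutive (sigma g).
Proof. by move=> i; apply: val_inj; rewrite !sigma_val line_swapK. Qed.

Lemma tauK : involutive (tau g).
Proof. by move=> i; apply: val_inj; rewrite !tau_val line_swapK. Qed.

Local Open Scope group_scope.

Lemma line_trivialization (K : groupType) (alpha beta : squares -> K) :
  (forall i, alpha i * alpha (sigma g i) = 1) ->
  (forall i, sigma g i = i -> alpha i = 1) ->
  (forall i, beta i * beta (tau g i) = 1) ->
  (forall i, tau g i = i -> beta i = 1) ->
  exists kappa : squares -> K, forall i,
    kappa (sigma g i) = kappa i * alpha i /\ kappa (tau g i) = kappa i * beta i.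
Proof.
move=> a2 a1 b2 b1.
pose kap := fix kap n : K := if n is n'.+1 then
  kap n' * (if odd n' then beta (inord n') else alpha (inord n')) else 1.
have ii (i : squares) : inord i = i :> squares by apply: val_inj; rewrite /= inordK.
exists (fun i => kap (val i)) => i; split.
- have := sigma_val i; rewrite /line_swap.
  case: ifP => h; last first.
    move=> e; have e' : sigma g i = i by exact: val_inj.
    by rewrite e' a1// mulg1.
  rewrite subn0; case: ifP => ho e.
    have e' : val i = (val (sigma g i)).+1.
      by rewrite e /=; move: ho; case: (nat_of_ord i).
    rewrite e' /=; have -> : odd (sigma g i) = false.
      by rewrite [nat_of_ord _]e; case: (nat_of_ord i) ho => //= k /negbTE.
    by have e3 := a2 (sigma g i); rewrite sigmaK in e3; rewrite ii -mulgA e3 mulg1.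
  by rewrite e /= ho ii.
- have := tau_val i; rewrite /line_swap.
  case: ifP => h; last first.
    move=> e; have e' : tau g i = i by exact: val_inj.
    by rewrite e' b1// mulg1.
  case: ifP => ho e.
    have e' : val i = (val (tau g i)).+1.
      by rewrite e /=; move: h; case: (nat_of_ord i).
    rewrite e' /=; have -> : odd (tau g i).
      by rewrite [nat_of_ord _]e; case: (nat_of_ord i) h ho => //= k; rewrite subn1 /=; case: k.
    by have e3 := b2 (tau g i); rewrite tauK in e3; rewrite ii -mulgA e3 mulg1.
  have oi : odd i by lia.
  by rewrite e /= oi ii.
Qed.

End SquarePermutations.

Section Euclid.
Variable R : realType.
Implicit Types p q : R * R.

Lemma euclid_ge0 p q : 0 <= euclid p q. Proof. exact: sqrtr_ge0. Qed.

Lemma euclid_sym p q : euclid p q = euclid q p.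
Proof. by rewrite /euclid -sqrrN opprB -[(p.2 - q.2) ^+ 2]sqrrN opprB. Qed.

Lemma euclid_le p q : euclid p q <= `|p.1 - q.1| + `|p.2 - q.2|.
Proof.
have h : 0 <= `|p.1 - q.1| + `|p.2 - q.2| by rewrite addr_ge0.
rewrite -(ger0_norm h) -sqrtr_sqr ler_wsqrtr// [leRHS]sqrrD !real_normK ?num_real//.
by rewrite lerD2r lerDl mulrn_wge0// mulr_ge0.
Qed.

(** Exchanging coordinates turns vertical strips into horizontal ones, so that the strip lemmas
    serve both. *)
Definition swap_pt p : R * R := (p.2, p.1).

Lemma euclid_swap p q : euclid (swap_pt p) (swap_pt q) = euclid p q.
Proof. by rewrite /euclid /= addrC. Qed.

Lemma rect1_swap p : rect 1 (swap_pt p) = rect 1 p.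
Proof. by rewrite /rect /= andbC. Qed.

End Euclid.

Section StaircaseGeometry.
Variables (R : realType) (g : nat).
Hypothesis g1 : (1 < g)%N.
Local Notation Zg := (Zg R g).
Local Notation squares := (squares g).
Local Notation Zdist := (@Zdist R g).
Local Notation polyline := (@polyline R g).
Implicit Types (z w : Zg) (i : squares) (p q : R * R).

Lemma polyline_cat z w v k l : polyline z w k -> polyline w v l ->
  polyline z v (k + l).
Proof.
move=> h; elim=> [|i p q l' _ ih]; first by rewrite addr0.
by rewrite addrA; exact: Polyline_step.
Qed.

Lemma polyline_segment i (p q : unit_square R) :
  polyline (Zpoint i p) (Zpoint i q) (euclid (val p) (val q)).
Proof. by rewrite -[euclid _ _]add0r; apply: Polyline_step; exact: Polyline_nil. Qed.

Lemma polyline_rev z w l : polyline z w l -> polyline w z l.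
Proof.
elim=> [|i p q l' _ ih]; first exact: Polyline_nil.
by rewrite addrC euclid_sym; exact: polyline_cat (polyline_segment i q p) ih.
Qed.

Lemma polyline_ge0 z w l : polyline z w l -> 0 <= l.
Proof. by elim=> // i p q l' _ h; rewrite addr_ge0 ?euclid_ge0. Qed.

Lemma Zdist_le z w l : polyline z w l -> Zdist z w <= l.
Proof. by move=> h; apply: ge_inf => //; exists 0 => a; exact: polyline_ge0. Qed.

Lemma Zdist_ge0 z w : 0 <= Zdist z w.
Proof.
rewrite /Defs.Zdist; set A := (X in inf X).
have [->|/set0P A0] := eqVneq A set0; first by rewrite inf0.
by apply: lb_le_inf => // a; exact: polyline_ge0.
Qed.

Lemma Zdist_sym z w : Zdist z w = Zdist w z.
Proof. by congr inf; apply/seteqP; split=> l; exact: polyline_rev. Qed.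

Lemma glue_eq (i j : squares) (p q : unit_square R) : Defs.glue (i, p) (j, q) ->
  Zpoint i p = Zpoint j q.
Proof. by move=> h; apply/eqmodP/asboolP; exact: rst_step. Qed.

Lemma rho_invE i (p : unit_square R) : rho_inv i (val p) = Zpoint i p.
Proof. by rewrite /rho_inv valKd. Qed.

Lemma rect1P p : rect 1 p -> exists u : unit_square R, val u = p.
Proof. by move=> h; exists (Sub p h); rewrite SubK. Qed.

Lemma rho_inv_left_right i (y : R) : 0 <= y <= 1 ->
  rho_inv i (0, y) = rho_inv (sigma g i) (1, y) :> Zg.
Proof.
move=> hy.
have [u hu] : exists u : unit_square R, val u = (0, y).
  by apply: rect1P; rewrite /rect /= lexx ler01.
have [v hv] : exists u : unit_square R, val u = (1, y).
  by apply: rect1P; rewrite /rect /= lexx ler01.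
rewrite -hu -hv !rho_invE; apply: glue_eq; apply: Glue_left_right => //=;
  by rewrite ?hu ?hv.
Qed.

Lemma rho_inv_top_bottom i (x : R) : 0 <= x <= 1 ->
  rho_inv i (x, 1) = rho_inv (tau g i) (x, 0) :> Zg.
Proof.
move=> hx.
have [u hu] : exists u : unit_square R, val u = (x, 1).
  by apply: rect1P; rewrite /rect /= hx lexx ler01.
have [v hv] : exists u : unit_square R, val u = (x, 0).
  by apply: rect1P; rewrite /rect /= hx lexx ler01.
rewrite -hu -hv !rho_invE; apply: glue_eq; apply: Glue_top_bottom => //=;
  by rewrite ?hu ?hv.
Qed.

Lemma floorD1 (x : R) : Num.floor (x + 1) = Num.floor x + 1.
Proof. by rewrite floorDrz ?floor1// rpred1. Qed.

Lemma perm_zpowNS (s : {perm squares}) (n : nat) i : involutive s ->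
  perm_zpow s (- (n.+1)%:Z) i = perm_zpow s (- n%:Z) (s i).
Proof.
move=> sK; have e k : perm_zpow s (- k%:Z) = (s ^- k)%g.
  by case: k => [|k]; rewrite ?oppr0 //= expg0 invg1.
have sV : (s^-1)%g =1 s by move=> j; rewrite -{1}[j]sK permK.
by rewrite !e expgS invgM; rewrite -expVgn -expgSr expgS permM sV.
Qed.

Lemma hmap_shift i p : 0 <= p.1 -> hmap i (shift_pt p) = hmap (sigma g i) p.
Proof.
move=> p0; rewrite /hmap /= floorD1.
have : 0 <= Num.floor p.1 by rewrite floor_ge0.
case: (Num.floor p.1) => // n _.
have -> : n%:Z + 1 = n.+1%:Z by lia.
rewrite perm_zpowNS; last exact: sigmaK.
congr rho_inv; congr pair; rewrite -!pmulrn -natr1; lra.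
Qed.

Lemma hmap_square i p : rect 1 p -> hmap i p = rho_inv i p.
Proof.
case: p => x y /andP[/andP[/= x0 x1] hy]; rewrite /hmap /=.
have [x1'|x1'] := ltP x 1.
  have -> : Num.floor x = 0 by apply: floor_def; rewrite x0 /=.
  by rewrite oppr0 /= perm1 subr0.
(* Here the floor is already 1, and [hmap] yields a point on the left side of the next square, glued
   to the right side of square [i]. *)
have -> : x = 1 by apply/eqP; rewrite eq_le x1 x1'.
rewrite floor1 subrr /= expg1.
rewrite rho_inv_left_right//; congr rho_inv.
by rewrite permKV.
Qed.

Lemma vmap_shift i p : 0 <= p.1 ->
  vmap i (swap_pt (shift_pt p)) = vmap (tau g i) (swap_pt p).
Proof.
move=> p0; rewrite /vmap /= floorD1.
have : 0 <= Num.floor p.1 by rewrite floor_ge0.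
case: (Num.floor p.1) => // n _.
have -> : n%:Z + 1 = n.+1%:Z by lia.
rewrite /= expgS permM.
congr rho_inv; congr pair; rewrite -!pmulrn -natr1; lra.
Qed.

Lemma vmap_square i p : rect 1 p -> vmap i (swap_pt p) = rho_inv i (swap_pt p).
Proof.
case: p => x y /andP[/andP[/= x0 x1] hy]; rewrite /vmap /swap_pt /=.
have [x1'|x1'] := ltP x 1.
  have -> : Num.floor x = 0 by apply: floor_def; rewrite x0 /=.
  by rewrite /= perm1 subr0.
have -> : x = 1 by apply/eqP; rewrite eq_le x1 x1'.
by rewrite floor1 subrr /= expg1 rho_inv_top_bottom.
Qed.

End StaircaseGeometry.

(** * Distances along strips and connectedness of the staircase *)

Section StripDistance.
Variables (R : realType) (g : nat).
Hypothesis g1 : (1 < g)%N.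
Local Notation Zg := (Zg R g).
Local Notation squares := (squares g).
Local Notation Zdist := (@Zdist R g).
Local Notation polyline := (@polyline R g).
Implicit Types (z w : Zg) (i : squares) (p q : R * R).

Section Strip.
Variables (s : squares -> squares) (h : squares -> R * R -> Zg).
Hypothesis h_shift : forall i p, rect 2 p -> h i (shift_pt p) = h (s i) p.
Hypothesis h_seg : forall i p q, rect 1 p -> rect 1 q ->
  polyline (h i p) (h i q) (euclid p q).

Lemma strip_iter n i p : (n <= 2)%N -> rect 1 p ->
  h i (p.1 + n%:R, p.2) = h (iter n s i) p.
Proof.
elim: n i p => [|n ih] i p n2 hp; first by rewrite addr0; case: p hp.
have r2 : rect 2 (p.1 + n%:R, p.2).
  case: p hp => x y /andP[/andP[/= x0 x1] hy]; rewrite /rect /= hy andbT.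
  have : n%:R <= 1 :> R by rewrite (ler_nat _ n 1).
  have : 0 <= n%:R :> R by []; lra.
rewrite iterSr -ih// 1?ltnW// -h_shift//; congr (h i _).
by rewrite /shift_pt /= -natr1 addrA.
Qed.

(** Close points lie in one square or in consecutive ones. In the second case, go horizontally to
    the common side, at cost at most [delta], and then straight to the target, at cost at most
    [2 * delta]. *)
Let strip_Zdist_le delta i p q : 0 < delta -> delta <= 1 ->
  rect 3 p -> rect 3 q -> close_pt delta p q -> p.1 <= q.1 ->
  Zdist (h i p) (h i q) <= 3 * delta.
Proof.
move=> d0 d1 hp hq pq le12.
have [n [n2 [pn np]]] : exists n : nat, (n <= 2)%N /\ (n%:R <= p.1 /\ p.1 <= n%:R + 1).
  case/andP: (hp) => /andP[p0 p3] _.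
  have [h1|h1] := leP p.1 1; first by exists 0%N; split=> //; split=> //; rewrite add0r.
  have [h2|h2] := leP p.1 2; first by exists 1%N; split=> //; split; lra.
  by exists 2%N; split=> //; split; lra.
case: p q hp hq pq le12 pn np => x y [x' y'].
move=> /andP[/andP[/= x0 x3] hy] /andP[/andP[/= x0' x3'] hy'] /andP[/= xx yy] le12 pn np.
have eu a b a' b' : `|a - a'| <= delta -> `|b - b'| <= delta ->
    euclid (a, b) (a', b') <= 2 * delta.
  by move=> h1 h2; apply: le_trans (euclid_le _ _) _; rewrite /=; lra.
have sub a b : h i (a, b) = h i (((a - n%:R), b).1 + n%:R, (a - n%:R, b).2).
  by rewrite /= subrK.
have [h1|h1] := leP x' (n%:R + 1).
  rewrite (sub x) (sub x') !strip_iter//; try by rewrite /rect /= ?hy ?hy' andbT; lra.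
  apply: le_trans (Zdist_le (h_seg _ _ _)) _; try by rewrite /rect /= ?hy ?hy' andbT; lra.
  apply: le_trans (eu _ _ _ _ _ yy) _; last lra.
  by rewrite opprB addrA subrK.
(* There is a next square inside the strip, because [x'] exceeds [n + 1] and is at most 3. *)
have n1 : (n.+1 <= 2)%N.
  rewrite ltnS leqNgt; apply/negP => n1.
  have en : n = 2%N by apply/eqP; rewrite eqn_leq n2 n1.
  have : n%:R + 1 = 3 :> R by rewrite en natr1.
  by move=> e3; have := lt_le_trans h1 x3'; rewrite e3 ltxx.
have sub' a b : h i (a, b) = h i (((a - n.+1%:R), b).1 + n.+1%:R, (a - n.+1%:R, b).2).
  by rewrite /= subrK.
have x1 : x' - x <= delta by apply: le_trans xx; rewrite distrC ler_norm.
have nn : n.+1%:R = n%:R + 1 :> R by rewrite natr1.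
have e1 : h i (x, y) = h (iter n s i) (x - n%:R, y).
  by rewrite (sub x) strip_iter// /rect /= hy andbT; lra.
have e2 : h (iter n s i) (1, y) = h (iter n.+1 s i) (0, y).
  rewrite -!strip_iter//; try by rewrite /rect /= hy andbT; lra.
  by rewrite /= nn add0r addrC.
have e3 : h i (x', y') = h (iter n.+1 s i) (x' - n.+1%:R, y').
  by rewrite (sub' x') strip_iter// /rect /= hy' andbT nn; lra.
have l1 : polyline (h (iter n s i) (x - n%:R, y)) (h (iter n s i) (1, y))
    (euclid (x - n%:R, y) (1, y)).
  by apply: h_seg; rewrite /rect /= hy andbT; lra.
have l2 : polyline (h (iter n.+1 s i) (0, y)) (h (iter n.+1 s i) (x' - n.+1%:R, y'))
    (euclid (0, y) (x' - n.+1%:R, y')).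
  by apply: h_seg; rewrite /rect /= ?hy ?hy' andbT; lra.
rewrite -e2 in l2; rewrite e1 e3.
apply: le_trans (Zdist_le (polyline_cat l1 l2)) _.
have -> : 3 * delta = delta + 2 * delta by ring.
apply: lerD.
  apply: le_trans (euclid_le _ _) _; rewrite /= subrr normr0 addr0 distrC ger0_norm; lra.
by apply: eu yy; rewrite sub0r normrN ger0_norm; lra.
Qed.

Lemma strip_Zdist delta i p q : 0 < delta -> delta <= 1 ->
  rect 3 p -> rect 3 q -> close_pt delta p q -> 
  Zdist (h i p) (h i q) <= 3 * delta.
Proof.
move=> d0 d1 hp hq pq; have [h1|/ltW h1] := leP p.1 q.1.
  exact: strip_Zdist_le.
by rewrite Zdist_sym; apply: strip_Zdist_le => //; rewrite close_pt_sym.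
Qed.

End Strip.

Lemma rho_inv_segment i p q : rect 1 p -> rect 1 q ->
  polyline (rho_inv i p) (rho_inv i q) (euclid p q).
Proof.
move=> /rect1P[u <-] /rect1P[v <-]; rewrite !rho_invE; exact: polyline_segment.
Qed.

Lemma hmap_Zdist delta i p q : 0 < delta -> delta <= 1 ->
  rect 3 p -> rect 3 q -> close_pt delta p q ->
  Zdist (hmap i p) (hmap i q) <= 3 * delta.
Proof.
move=> d0 d1; apply: (@strip_Zdist (sigma g)) => // [i' p'|i' p' q' hp hq].
  by move=> /andP[/andP[p0 _] _]; exact: hmap_shift.
by rewrite !hmap_square//; exact: rho_inv_segment.
Qed.

Lemma vmap_Zdist delta i p q : 0 < delta -> delta <= 1 ->
  rect 3 p -> rect 3 q -> close_pt delta p q ->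
  Zdist (vmap i (swap_pt p)) (vmap i (swap_pt q)) <= 3 * delta.
Proof.
move=> d0 d1; apply: (@strip_Zdist (tau g) (fun i p => vmap i (swap_pt p))) => //
  [i' p'|i' p' q' hp hq].
  by move=> /andP[/andP[p0 _] _]; exact: vmap_shift.
by rewrite !vmap_square// -euclid_swap; apply: rho_inv_segment; rewrite rect1_swap.
Qed.

Lemma Zpoint_repr z : exists i u, z = Zpoint i u.
Proof.
exists (generic_quotient.repr z).1, (generic_quotient.repr z).2.
by rewrite /Zpoint -surjective_pairing reprK.
Qed.

(** Consecutive squares share a side through [sigma] or [tau]. This makes [Zdist] an infimum over a
    nonempty set, not the default value 0. *)
Lemma polyline_conn z w : exists l, polyline z w l.
Proof.
pose conn z w := exists l, polyline z w l.
have tr a b c : conn a b -> conn b c -> conn a c.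
  by move=> [k hk] [l hl]; exists (k + l); exact: polyline_cat hk hl.
have sy a b : conn a b -> conn b a by move=> [l /polyline_rev]; exists l.
have sq i p q : rect 1 p -> rect 1 q -> conn (rho_inv i p) (rho_inv i q).
  by move=> hp hq; eexists; exact: rho_inv_segment.
have r00 : rect 1 ((0, 0) : R * R) by rewrite rect00.
have r10 : rect 1 ((1, 0) : R * R) by rewrite /rect /= !lexx ler01.
have r01 : rect 1 ((0, 1) : R * R) by rewrite /rect /= !lexx ler01.
have step n (hn : (n.+1 < (g.-1.*2).+1)%N) :
    conn (rho_inv (inord n) (0, 0)) (rho_inv (inord n.+1) (0, 0)).
  have vn : val (inord n : squares) = n by rewrite /= inordK// ltnW.
  have vn1 : val (inord n.+1 : squares) = n.+1 by rewrite /= inordK.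
  have [on|on] := boolP (odd n).
    have -> : (inord n.+1 : squares) = tau g (inord n).
      apply: val_inj; rewrite vn1 tau_val// /= vn /line_swap.
      have -> : (1 <= n < 1 + (g.-1).*2)%N by lia.
      by have -> : odd (n - 1) = false by lia.
    apply: tr (sq _ _ (0, 1) _ _) _ => //.
    by rewrite rho_inv_top_bottom ?lexx ?ler01//; exact: sq.
  have -> : (inord n.+1 : squares) = sigma g (inord n).
    apply: val_inj; rewrite vn1 sigma_val// /= vn /line_swap.
    have -> : (0 <= n < 0 + (g.-1).*2)%N by lia.
    by rewrite subn0 (negbTE on).
  by rewrite rho_inv_left_right ?lexx ?ler01//; exact: sq.
have base n : (n < (g.-1.*2).+1)%N ->
    conn (rho_inv (inord 0) (0, 0)) (rho_inv (inord n) (0, 0)).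
  elim: n => [|n ih] hn; first exact: sq.
  by apply: tr (ih (ltnW hn)) _; exact: step.
have all z' : conn (rho_inv (inord 0) (0, 0)) z'.
  have [i [u ->]] := Zpoint_repr z'; rewrite -rho_invE.
  have -> : i = inord i by apply: val_inj; rewrite /= inordK.
  by apply: tr (base i _) (sq _ _ _ _ _) => //; exact: (valP u).
exact: tr (sy _ _ (all z)) (all w).
Qed.

Lemma Zdist_polyline z w b : Zdist z w < b -> exists l, polyline z w l /\ l < b.
Proof. by move=> /(inf_lt (polyline_conn z w))[l h1 h2]; exists l. Qed.

End StripDistance.

Lemma lin_act_a2 (R : realType) (p : R * R) : lin_act a2 p = shear_pt p.
Proof.
by rewrite /lin_act /shear_pt !mxE /= mulr1z mulr0z mul1r mul0r add0r mul1r.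
Qed.

Lemma lin_act_b2 (R : realType) (p : R * R) :
  lin_act b2 p = swap_pt (shear_pt (swap_pt p)).
Proof.
rewrite /lin_act /shear_pt /swap_pt !mxE /= mulr1z mulr0z !mul1r mul0r addr0.
by rewrite addrC.
Qed.

(** * Gluing the developments of the strips *)

Section Trivialization.
Variables (R : realType) (g : nat).
Hypothesis g1 : (1 < g)%N.
Local Notation Zg := (Zg R g).
Local Notation squares := (squares g).
Variables (K : groupType) (c : Zg -> Zg -> K) (near : Zg -> Zg -> Prop).
Variables (fa fb : Zg -> Zg) (delta : R).
Hypothesis d0 : 0 < delta.
Hypothesis near_refl : forall x, near x x.
Hypothesis cc : forall x y z, near x y -> near y z -> (c x y * c y z = c x z)%g.
Hypothesis h_near : forall i p q, rect 3 p -> rect 3 q -> close_pt delta p q ->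
  near (hmap i p) (hmap i q).
Hypothesis v_near : forall i p q, rect 3 p -> rect 3 q -> close_pt delta p q ->
  near (vmap i (swap_pt p)) (vmap i (swap_pt q)).
Hypothesis fa_twist : forall i p, fa (Zpoint i p) = hmap i (lin_act a2 (val p)).
Hypothesis fb_twist : forall i p, fb (Zpoint i p) = vmap i (lin_act b2 (val p)).
Hypothesis fa_near : forall x, near x (fa x).
Hypothesis fb_near : forall x, near x (fb x).

(** Passing to the next square changes [F] by [alpha] and [kappa] by the same factor, so a formula
    valid on the first square of every strip spreads to all three. *)
Let rect_shift_strip (s : squares -> squares) (h : squares -> R * R -> Zg)
  (kappa alpha : squares -> K) (F : squares -> R * R -> K) (phi : Zg -> K) :
  (forall i, kappa (s i) = kappa i * alpha i)%g ->
  (forall i p, 0 <= p.1 -> h i (shift_pt p) = h (s i) p) ->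
  (forall i p, rect 2 p -> F i (shift_pt p) = alpha i * F (s i) p)%g ->
  (forall i p, rect 1 p -> phi (h i p) = kappa i * F i p)%g ->
  forall i p, rect 3 p -> phi (h i p) = (kappa i * F i p)%g.
Proof.
move=> ks hs Fs ph.
have ext (B : R) : 0 <= B -> B <= 2 ->
    (forall i p, rect B p -> phi (h i p) = kappa i * F i p)%g ->
    (forall i p, rect (B + 1) p -> phi (h i p) = kappa i * F i p)%g.
  move=> B0 B2 ih i [x y]; have [x1|x1] := leP x 1.
    by move=> /andP[/andP[/= x0 _] hy]; apply: ph; rewrite /rect /= x0 x1.
  move=> /andP[/andP[/= x0 xB] hy].
  have -> : (x, y) = shift_pt (x - 1, y) by rewrite /shift_pt /= subrK.
  have hB : rect B (x - 1, y) by rewrite /rect /= hy andbT; lra.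
  rewrite hs /=; last lra.
  by rewrite Fs ?ih// ?ks ?mulgA//; exact: rectW hB.
have e2 := ext 1 ler01 (_ : 1 <= 2) ph.
have e3 := ext (1 + 1) (_ : 0 <= 1 + 1) (_ : 1 + 1 <= 2) (e2 _).
move=> i p hp; apply: e3; try lra.
by apply: rectW hp; lra.
Qed.

(** The horizontal and vertical developments are made to agree on each square; [kappa] then absorbs
    their monodromies, so that the primitives on the squares match on glued sides. The jumps are
    controlled because [phi] agrees with the developments along whole strips. *)
Lemma staircase_trivialization : exists phi : Zg -> K,
  [/\ forall i u v, close_pt delta (val u) (val v) ->
        c (Zpoint i u) (Zpoint i v) = ((phi (Zpoint i u))^-1 * phi (Zpoint i v))%g,
      forall z, c z (fa z) = ((phi z)^-1 * phi (fa z))%g &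
      forall z, c z (fb z) = ((phi z)^-1 * phi (fb z))%g].
Proof.
have delta0 := d0.
pose v i p : Zg := vmap i (swap_pt p).
have h_shift i p : 0 <= p.1 -> hmap i (shift_pt p) = hmap (sigma g i) p :> Zg.
  exact: hmap_shift.
have v_shift i p : 0 <= p.1 -> v i (shift_pt p) = v (tau g i) p.
  exact: vmap_shift.
have fa_h i p : rect 1 p -> fa (hmap i p) = hmap i (shear_pt p).
  move=> hp; have [u hu] := rect1P hp.
  by rewrite hmap_square// -hu rho_invE fa_twist lin_act_a2.
have fb_v i p : rect 1 p -> fb (v i p) = v i (shear_pt p).
  move=> hp; have hp' := hp; rewrite -rect1_swap in hp'; have [u hu] := rect1P hp'.
  rewrite /v vmap_square// -hu rho_invE fb_twist lin_act_b2 hu.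
  by case: p {hp hp' hu}.
have r2 (p : R * R) : rect 2 p -> 0 <= p.1 by move=> /andP[/andP[]].
have [F [alpha [F1 F2 al2 al1 F3]]] := strip_holonomy near_refl cc (@sigmaK g g1) delta0
  h_near (fun i p hp => h_shift i p (r2 p hp)) fa_h fa_near.
have [G0 [beta0 [G01 G02 be02 be01 G03]]] := strip_holonomy near_refl cc (@tauK g g1) delta0
  v_near (fun i p hp => v_shift i p (r2 p hp)) fb_v fb_near.
(* A primitive may be multiplied on the left by a constant; this one makes the vertical development
   equal the horizontal one at the corner of each square. *)
have [ga gaE] : exists ga : squares -> K,
    forall i, (ga i * G0 i (0%R, 0%R) = F i (0%R, 0%R))%g.
  by exists (fun i => F i (0%R, 0%R) * (G0 i (0%R, 0%R))^-1)%g => i; rewrite mulgVK.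
pose G i p := (ga i * G0 i p)%g.
pose beta i := (ga i * beta0 i * (ga (tau g i))^-1)%g.
have G1 i p q : rect 3 p -> rect 3 q -> close_pt delta p q ->
    c (v i p) (v i q) = ((G i p)^-1 * G i q)%g.
  by move=> hp hq pq; rewrite G01// /G invgM -mulgA mulKg.
have G2 i p : rect 2 p -> G i (shift_pt p) = (beta i * G (tau g i) p)%g.
  by move=> hp; rewrite /G G02// /beta !mulgA mulgVK.
have be2 i : (beta i * beta (tau g i) = 1)%g.
  rewrite /beta tauK// !mulgA mulgVK -(mulgA (ga i)) be02 mulg1.
  by rewrite mulgV.
have be1 i : tau g i = i -> beta i = 1%g.
  by move=> e; rewrite /beta e be01// mulg1 mulgV.
have G3 i p : rect 1 p -> c (v i p) (fb (v i p)) = ((G i p)^-1 * G i (shear_pt p))%g.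
  by move=> hp; rewrite G03// /G invgM -mulgA mulKg.
have r13 (p : R * R) : rect 1 p -> rect 3 p by apply: rectW; lra.
have vh i p : rect 1 p -> v i (swap_pt p) = hmap i p.
  move=> hp; rewrite hmap_square// /v vmap_square ?rect1_swap//.
  by case: p hp.
(* Both are primitives of the same cocycle on the square, so their quotient is locally constant. *)
have FG i p : rect 1 p -> F i p = G i (swap_pt p).
  pose w p := (F i p * (G i (swap_pt p))^-1)%g.
  move=> hp; suff : w p = 1%g by move=> /divg1_eq.
  have -> : 1%g = w (0, 0).
    by rewrite /w /G /swap_pt /= gaE mulgV.
  apply: (@locally_constant _ _ w 1 delta) => // {hp}p q hp hq pq.
  have := F1 i p q (r13 _ hp) (r13 _ hq) pq; rewrite -!vh// G1.
  - move=> e; apply: (@mulgI _ (F i p)^-1%g).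
    by rewrite /w mulKg mulgA -e mulgK.
  - by apply: r13; rewrite rect1_swap.
  - by apply: r13; rewrite rect1_swap.
  - by move: pq; rewrite /close_pt /= andbC.
have [kappa hk] := line_trivialization g1 al2 al1 be2 be1.
(* A primitive on the disjoint union of the squares; compatibility with [glue] lets it descend to
   the surface. *)
pose psi (x : square_point R g) : K := (kappa x.1 * F x.1 (val x.2))%g.
have psi_glue x y : Defs.glue x y -> psi x = psi y.
  case: x y => i u [j w] [/= -> u1 w1 e|/= -> u2 w2 e].
    have hy : 0 <= (val u).2 <= 1 by case/andP: (valP u).
    have -> : psi (i, u) = (kappa i * F i (0%R, (val u).2))%g.
      by rewrite /psi /= -u1 -surjective_pairing.
    have -> : psi (sigma g i, w) = (kappa (sigma g i) * F (sigma g i) (shift_pt (0, (val u).2)))%g.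
      by rewrite /psi /shift_pt /= add0r e -w1 -surjective_pairing.
    rewrite F2; last by rewrite /rect /= hy lexx andbT; lra.
    by rewrite sigmaK// (hk i).1 mulgA -(mulgA (kappa i)) al2 mulg1.
  have hx : 0 <= (val u).1 <= 1 by case/andP: (valP u).
  have -> : psi (i, u) = (kappa i * G i (shift_pt (0, (val u).1)))%g.
    rewrite /psi /= FG; last exact: (valP u).
    by rewrite /shift_pt /= add0r /swap_pt -u2.
  have -> : psi (tau g i, w) = (kappa (tau g i) * G (tau g i) (0%R, (val u).1))%g.
    rewrite /psi /= FG; last exact: (valP w).
    by rewrite /swap_pt w2 e.
  rewrite G2; last by rewrite /rect /= hx lexx andbT; lra.
  by rewrite (hk i).2 mulgA.
pose phi (z : Zg) : K := psi (generic_quotient.repr z).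
have phiE i u : phi (Zpoint i u) = (kappa i * F i (val u))%g.
  have /asboolP : glued (generic_quotient.repr (Zpoint i u)) (i, u).
    by apply/eqmodP; rewrite reprK.
  rewrite /phi -[RHS]/(psi (i, u)); by elim=> // x y z _ -> _ ->.
have phih i p : rect 3 p -> phi (hmap i p) = (kappa i * F i p)%g.
  apply: (rect_shift_strip (fun i => (hk i).1) h_shift F2) => {}i {}p hp.
  by rewrite hmap_square//; have [u <-] := rect1P hp; rewrite rho_invE phiE.
have phiv i p : rect 3 p -> phi (v i p) = (kappa i * G i p)%g.
  apply: (rect_shift_strip (fun i => (hk i).2) v_shift G2) => {}i {}p hp.
  have -> : v i p = hmap i (swap_pt p).
    by rewrite -vh ?rect1_swap//; case: p hp.
  rewrite phih; last by apply: r13; rewrite rect1_swap.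
  by rewrite FG ?rect1_swap//; case: p {hp}.
have r3s (p : R * R) : rect 1 p -> rect 3 (shear_pt p).
  case: p => x y /andP[/andP[/= x0 x1] /andP[/= y0 y1]].
  by rewrite /rect /shear_pt /= y0 y1 andbT; lra.
exists phi; split.
- move=> i u w uw; have hu : rect 1 (val u) by exact: (valP u).
  have hw : rect 1 (val w) by exact: (valP w).
  rewrite !phiE -!rho_invE -!hmap_square// F1 ?r13//.
  by rewrite invgM -mulgA mulKg.
- move=> z; have [i [u ->]] := Zpoint_repr z.
  have hu : rect 1 (val u) by exact: (valP u).
  rewrite -rho_invE -hmap_square// F3// fa_h// !phih ?r3s ?r13//.
  by rewrite invgM -mulgA mulKg.
- move=> z; have [i [u ->]] := Zpoint_repr z.
  have hu : rect 1 (swap_pt (val u)) by rewrite rect1_swap; exact: (valP u).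
  have -> : Zpoint i u = v i (swap_pt (val u)).
    by rewrite vh ?hmap_square ?rho_invE//; exact: (valP u).
  rewrite G3// fb_v// !phiv ?r3s ?r13//.
  by rewrite [in RHS]invgM -[RHS]mulgA mulKg.
Qed.

End Trivialization.

(** * Cocycles on the warped cone of the staircase *)

Lemma word_ball_wchain (R : realType) (G : groupType) (S : set G) (Y : Type)
    (d : Y -> Y -> R) (act : G -> Y -> Y) k w :
  symmetric_set S -> group_action act -> word_ball S k w ->
  forall x, exists2 m, (m <= k)%N & wchain S d act x (act w x) m 0.
Proof.
move=> Ssym act_act [l [lk lS ->]] x; exists (size l) => // {lk}.
elim: l lS => [|s l ih] lS /=.
  by rewrite big_nil act_act.1; exact: Wchain_nil.
rewrite big_cons act_act.2; apply: Wchain_jump.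
  have := lS s; rewrite inE eqxx => /(_ isT)[//|/Ssym]; by rewrite invgK.
by apply: ih => u ul; apply: lS; rewrite inE ul orbT.
Qed.

Lemma finite_uniform (R : realDomainType) (T : Type) (A : set T) (P : T -> R -> Prop) :
  finite_set A -> (forall x M M', M <= M' -> P x M -> P x M') ->
  (forall x, exists M, P x M) -> exists M, forall x, A x -> P x M.
Proof.
move=> finA mono /choice[f hf].
have /finite_seqP[s hs] : finite_set (f @` A) by exact: finite_image.
exists (\big[Num.max/0]_(M <- s) M) => x Ax; apply: mono (hf x).
have : (f @` A) (f x) by exists x.
rewrite hs /=; elim: (s) => //= M s' ih; rewrite inE big_cons le_max => /orP[/eqP ->|/ih ->].
  by rewrite lexx.
by rewrite orbT.
Qed.

Section StaircaseCoboundary.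
Variables (R : realType) (g : nat) (act : F2 -> Zg R g -> Zg R g) (T : set F2).
Hypothesis g1 : (1 < g)%N.
Hypothesis hact : multitwist_action act.
Hypothesis Tfin : finite_set T.
Hypothesis Tsym : symmetric_set T.
Hypothesis Tgen : generates T.
Local Notation Zg := (Zg R g).
Local Notation Zdist := (@Zdist R g).
Local Notation wd t := (warped_dist T Zdist act t).
Local Notation wchain := (wchain T Zdist act).

Let act_act : group_action act. Proof. by case: hact. Qed.

Let wd_le t z w k l : 0 <= t -> wchain z w k l -> wd t z w <= k%:R + t * l.
Proof.
by move=> t0; apply: warped_dist_chain_le => //; exact: Zdist_ge0.
Qed.

Let wd_refl t z : 0 <= t -> wd t z z = 0.
Proof.
by move=> t0; apply: warped_dist_refl => //; exact: Zdist_ge0.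
Qed.

Lemma jump_bound h : exists b : R, forall t z, 0 <= t -> wd t z (act h z) <= b.
Proof.
have [k hk] := Tgen h; exists k%:R => t z t0.
have [m mk ch] := word_ball_wchain Zdist Tsym act_act hk z.
by apply: le_trans (wd_le t0 ch) _; rewrite mulr0 addr0 ler_nat.
Qed.

(** The primitive is controlled only on [gen_a] and [gen_b], whereas the cone is warped by an
    arbitrary generating set. Induction over the generation of [F2] extends the control to [h]; [M]
    bounds the intermediate jumps and does not depend on [t]. *)
Lemma jump_coboundary (h : F2) : exists M : R, forall rho (K : groupType)
    (c : Zg -> Zg -> K) (phi : Zg -> K) t, M <= rho -> 0 <= rho -> 0 <= t ->
  cocycle (wd t) rho c ->
  (forall z, c z (act gen_a z) = ((phi z)^-1 * phi (act gen_a z))%g) ->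
  (forall z, c z (act gen_b z) = ((phi z)^-1 * phi (act gen_b z))%g) ->
  forall z, c z (act h z) = ((phi z)^-1 * phi (act h z))%g.
Proof.
have : in_F2 (val h) by exact: F2P.
move: {-2}(val h) (erefl (val h)) => N hN inN; elim: inN h hN => {N}.
- move=> h hN; exists 0 => rho K c phi t _ rho0 t0 cc _ _ z.
  have -> : h = 1%g by apply: val_inj.
  rewrite act_act.1 mulVg (cocycle_refl rho0 _ cc)// => x; exact: wd_refl.
- move=> h hN; exists 0 => rho K c phi t _ rho0 t0 cc ha hb z.
  by have -> : h = gen_a by apply: val_inj.
- move=> h hN; exists 0 => rho K c phi t _ rho0 t0 cc ha hb z.
  by have -> : h = gen_b by apply: val_inj.
- move=> M N inM ihM inN ihN h hN.
  pose m := mkF2 inM; pose n := mkF2 inN.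
  have [A1 h1] := ihM m erefl; have [A2 h2] := ihN n erefl.
  have [b1 hb1] := jump_bound m; have [b2 hb2] := jump_bound n.
  exists (Num.max (Num.max A1 A2) (Num.max b1 b2)) => rho K c phi t.
  rewrite !ge_max => /andP[/andP[a1 a2] /andP[a3 a4]] rho0 t0 cc ha hb z.
  have -> : h = (m * n)%g by apply: val_inj.
  rewrite act_act.2 -(cc z (act n z)).
  + by rewrite (h1 rho K c phi t)// (h2 rho K c phi t)// -mulgA mulKVg.
  + exact: le_trans (hb2 _ _ t0) a4.
  + exact: le_trans (hb1 _ _ t0) a3.
- move=> M inM ihM h hN.
  pose m := mkF2 inM; have [A1 h1] := ihM m erefl; have [b1 hb1] := jump_bound m.
  exists (Num.max A1 b1) => rho K c phi t.
  rewrite ge_max => /andP[a1 a2] rho0 t0 cc ha hb z.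
  have -> : h = (m^-1)%g by apply: val_inj.
  have e : act m (act m^-1%g z) = z by rewrite -act_act.2 mulgV act_act.1.
  have := h1 rho K c phi t a1 rho0 t0 cc ha hb (act m^-1%g z); rewrite e => e2.
  have dC x y : wd t x y = wd t y x by exact: warped_dist_sym.
  rewrite (cocycle_sym rho0 (fun x => wd_refl x t0) dC cc (_ : wd t (act m^-1%g z) z <= rho)).
    by rewrite e2 invgM invgK.
  by apply: le_trans a2; rewrite -{2}e; exact: hb1.
Qed.

(** Subdivide the segment into steps of size at most [delta]. Its points are no further from its
    origin than its end is, so they all stay within [rho] of [z] and the cocycle relation can be
    applied repeatedly. *)
Lemma segment_coboundary (K : groupType) (c : Zg -> Zg -> K) (phi : Zg -> K)
    (delta rho t : R) z i (u v : unit_square R) :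
  0 < delta -> cocycle (wd t) rho c ->
  (forall u v, close_pt delta (val u) (val v) ->
     c (Zpoint i u) (Zpoint i v) = ((phi (Zpoint i u))^-1 * phi (Zpoint i v))%g) ->
  (forall u v, close_pt delta (val u) (val v) ->
     wd t (Zpoint i u) (Zpoint i v) <= rho) ->
  (forall w, euclid (val u) (val w) <= euclid (val u) (val v) ->
     wd t z (Zpoint i w) <= rho) ->
  c z (Zpoint i u) = ((phi z)^-1 * phi (Zpoint i u))%g ->
  c z (Zpoint i v) = ((phi z)^-1 * phi (Zpoint i v))%g.
Proof.
move=> d0 cc loc locd seg base.
pose N := (Num.truncn delta^-1).+1.
have N0 : 0 < N%:R :> R by rewrite ltr0n.
have Nd : N%:R^-1 <= delta.
  by rewrite -[delta]invrK lef_pV2 ?posrE ?invr_gt0//; exact/ltW/truncnS_gt.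
pose pt (j : nat) : R * R :=
  ((val u).1 + j%:R / N%:R * ((val v).1 - (val u).1),
   (val u).2 + j%:R / N%:R * ((val v).2 - (val u).2)).
have sq (x y s : R) : 0 <= x <= 1 -> 0 <= y <= 1 -> 0 <= s <= 1 ->
    0 <= x + s * (y - x) <= 1.
  move=> /andP[x0 x1] /andP[y0 y1] /andP[s0 s1].
  have -> : x + s * (y - x) = (1 - s) * x + s * y by ring.
  apply/andP; split; first by rewrite addr_ge0// mulr_ge0// subr_ge0.
  apply: (@le_trans _ _ ((1 - s) * 1 + s * 1)); last by rewrite !mulr1 subrK.
  by rewrite lerD// ler_wpM2l// subr_ge0.
have [/andP[ux uy] /andP[vx vy]] : rect 1 (val u) /\ rect 1 (val v).
  by split; [exact: (valP u)|exact: (valP v)].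
have ptr j : (j <= N)%N -> rect 1 (pt j).
  by move=> jN; rewrite /rect /= !sq//; exact: frac_itv.
have ptc j : (j < N)%N -> close_pt delta (pt j) (pt j.+1).
  move=> jN; have st (x y : R) : 0 <= x <= 1 -> 0 <= y <= 1 ->
      `|x + j%:R / N%:R * (y - x) - (x + j.+1%:R / N%:R * (y - x))| <= delta.
    move=> hx hy; rewrite opprD addrACA subrr add0r -mulrBl -mulrBl -natr1 opprD addNKr.
    rewrite !normrM normrN1 mul1r normfV normr_nat.
    apply: le_trans Nd; rewrite ler_piMr ?invr_ge0//; rewrite ler_norml; lra.
  by rewrite /close_pt !st.
have ptd j : (j <= N)%N -> euclid (val u) (pt j) <= euclid (val u) (val v).
  move=> jN; rewrite /euclid ler_wsqrtr//=.
  have /andP[s0 s1] := frac_itv R (ltn0Sn _) jN.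
  have st (x y s : R) : 0 <= s -> s <= 1 -> (x - (x + s * (y - x))) ^+ 2 <= (x - y) ^+ 2.
    move=> h0 h1; have -> : (x - (x + s * (y - x))) ^+ 2 = s ^+ 2 * (x - y) ^+ 2 by ring.
    by rewrite ler_piMl ?sqr_ge0// expr_le1.
  by rewrite lerD// st.
have key j : (j <= N)%N -> forall w, val w = pt j ->
    c z (Zpoint i w) = ((phi z)^-1 * phi (Zpoint i w))%g.
  elim: j => [|j ih] jN w hw.
    have -> : w = u; last exact: base.
    by apply: val_inj; rewrite hw /pt !mul0r !addr0 -surjective_pairing.
  have [w' hw'] := rect1P (ptr j (ltnW jN)).
  have cl : close_pt delta (val w') (val w) by rewrite hw hw'; exact: ptc.
  rewrite -(cc z (Zpoint i w')).
  + by rewrite (ih (ltnW jN))// loc// -mulgA mulKVg.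
  + by apply: seg; rewrite hw'; apply: ptd; exact: ltnW.
  + exact: locd.
apply: (key N) => //.
by rewrite /pt divff ?gt_eqF// !mul1r ![_ + (_ - _)]addrC !subrK -surjective_pairing.
Qed.

(** Points at warped distance at most [s] are joined by a chain of cost less than [s + 1]; the
    coboundary identity is carried from [z] along it, through jumps and segments. The scale [rho] is
    the same at all levels, while the scale [1 / t] used on the squares shrinks. *)
Lemma staircase_coboundary (s : R) : 0 <= s -> exists rho : R, 0 <= rho /\
  forall n (K : groupType) (c : Zg -> Zg -> K),
  (exists m, warped_admissible T Zdist act n.+1%:R m) ->
  cocycle (warped_cone T Zdist act n) rho c ->
  coboundary (warped_cone T Zdist act n) s c.
Proof.
move=> s0.
have [ba hba] := jump_bound gen_a; have [bb hbb] := jump_bound gen_b.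
have [M hM] := finite_uniform Tfin (fun h A1 A2 (h12 : A1 <= A2) H rho K c phi t
  (h : A2 <= rho) => H rho K c phi t (le_trans h12 h)) jump_coboundary.
(* [M] serves the jumps in [T]; [s + 3] covers both the chain, of cost at most [s + 1], and short
   moves on a strip, of cost at most 3; [ba] and [bb] bound the jumps by [gen_a] and [gen_b]. *)
pose rho := Num.max (Num.max M (s + 3)) (Num.max ba bb).
have [r1 r2 r3 r4] : [/\ M <= rho, s + 3 <= rho, ba <= rho & bb <= rho].
  by rewrite /rho !le_max !lexx !orbT.
have rho0 : 0 <= rho by lra.
exists rho; split=> // n K c adm cc.
rewrite /warped_cone in cc *; set t : R := n.+1%:R in adm cc *.
have t1 : 1 <= t by rewrite /t (ler_nat _ 1 n.+1).
have t0 : 0 <= t by lra.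
have tV : t * t^-1 = 1 by rewrite divff// /t pnatr_eq0.
have tV0 : 0 < t^-1 by rewrite invr_gt0; lra.
have tV1 : t^-1 <= 1 by rewrite invf_le1//; lra.
(* Points of a strip that are [1 / t] close in coordinates have warped distance at most 3, whatever
   [t] is. *)
have small z w : Zdist z w <= 3 * t^-1 -> wd t z w <= rho.
  move=> h; apply: le_trans (wd_le t0 (wchain_move1 _ _ _ z w)) _.
  rewrite add0r; apply: (@le_trans _ _ (t * (3 * t^-1))).
    by rewrite ler_wpM2l.
  by rewrite mulrCA tV; lra.
have [||||||||phi [hphi hphia hphib]] := @staircase_trivialization R g g1 K c
   (fun z w => wd t z w <= rho) (act gen_a) (act gen_b) t^-1 tV0.
- by move=> z; rewrite wd_refl.
- by [].
- by move=> i p q hp hq pq; apply: small; exact: hmap_Zdist.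
- by move=> i p q hp hq pq; apply: small; exact: vmap_Zdist.
- by case: hact.
- by case: hact.
- by move=> z; apply: le_trans r3; exact: hba.
- by move=> z; apply: le_trans r4; exact: hbb.
have jump h z : T h -> c z (act h z) = ((phi z)^-1 * phi (act h z))%g.
  by move=> Th; apply: (hM h Th rho K c phi t).
exists phi => z w zw.
have ch_rho y k l : wchain z y k l -> k%:R + t * l <= s + 1 -> wd t z y <= rho.
  by move=> h1 h2; apply: le_trans (wd_le t0 h1) _; lra.
have [k [l [ch lt]]] : exists k l, wchain z w k l /\ k%:R + t * l < s + 1.
  apply: warped_dist_chain => //; last lra.
  - exact: Zdist_ge0.
  - exact: Zdist_sym.
elim: ch lt => {w zw k l} [_|y w k l ch ih lt|h y k l Th ch ih lt].
- rewrite mulVg (cocycle_refl rho0 _ cc)// => x; exact: wd_refl.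
- have l0 : 0 <= Zdist y w by exact: Zdist_ge0.
  have tl0 : 0 <= t * Zdist y w by rewrite mulr_ge0.
  rewrite mulrDr in lt.
  (* The move is replaced by a polyline whose length fits the cost left over by the chain so far,
     and this is followed segment by segment. *)
  have [|l' [pl ltl]] := @Zdist_polyline _ _ g1 y w ((s + 1 - k%:R - t * l) * t^-1).
    by rewrite ltr_pdivlMr; lra.
  rewrite ltr_pdivlMr in ltl; last lra.
  have {}ih : c z y = ((phi z)^-1 * phi y)%g by apply: ih; lra.
  have {}ltl : k%:R + t * l + t * l' <= s + 1 by rewrite (mulrC t l'); lra.
  elim: pl ltl {l0 tl0 lt} => {w l'} [//|i u v l' pl ih2 lt].
  have e0 := euclid_ge0 (val u) (val v).
  have te0 : 0 <= t * euclid (val u) (val v) by rewrite mulr_ge0.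
  rewrite mulrDr in lt.
  apply: (@segment_coboundary K c phi t^-1 rho t z i u v) => //.
  + by move=> u' v'; exact: hphi.
  + move=> u' v' uv; apply: small; apply: le_trans (Zdist_le (polyline_segment _ _ _)) _.
    apply: le_trans (euclid_le _ _) _; case/andP: uv => h1 h2; apply: le_trans (lerD h1 h2) _.
    by move: (t^-1) tV0 => a a0; lra.
  + move=> w hw; have pw := polyline_cat pl (polyline_segment i u w).
    apply: ch_rho (Wchain_move (Zpoint i w) ch) _.
    have := Zdist_le pw; rewrite -(ler_pM2l (_ : 0 < t)); last lra.
    have : t * euclid (val u) (val w) <= t * euclid (val u) (val v) by rewrite ler_wpM2l.
    rewrite !mulrDr; lra.
  + by apply: ih2; lra.
- have lt' : k%:R + t * l < s + 1 by move: lt; rewrite -natr1; lra.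
  rewrite -(cc z y); first by rewrite ih// jump// -mulgA mulKVg.
    by apply: ch_rho ch _; lra.
  apply: le_trans (wd_le t0 (wchain_jump1 _ _ y Th)) _.
  by rewrite mulr0 addr0; lra.
Qed.

End StaircaseCoboundary.

(** Vanishing is tested on cocycles of the graph. These reduce to edges, whose images are at warped
    distance at most [L + A], and are then transported to the warped cone. *)
Lemma staircase_expander_vanishes (R : realType) (g : nat)
  (act : F2 -> Zg R g -> Zg R g) (T : set F2)
  (V : nat -> finType) (e : forall n : nat, rel (V n)) :
  (1 < g)%N -> multitwist_action act ->
  finite_set T -> symmetric_set T -> generates T -> expander R e ->
  quasi_isometric (fun n : nat => graph_dist R (@e n))
           (warped_cone T (@Zdist R g) act) ->
  exists (r0 : R) (n0 : nat), 0 < r0 /\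
     forall (r : R) (n : nat), r0 <= r -> (n0 <= n)%N ->
     forall x : V n, pi1r_vanishes (graph_dist R (@e n)) r x.
Proof.
move=> g1 hact Tfin Tsym Tgen hexp [L [A [L1 A0 [f hf]]]].
have act_act : group_action act by case: hact.
have LA0 : 0 <= L + A by lra.
have [rho [rho0 triv]] := staircase_coboundary g1 hact Tfin Tsym Tgen LA0.
have P1 : 0 <= L * (2 * rho + 3 * A + 2) by rewrite mulr_ge0//; lra.
have P2 : 0 <= L * (L + 4 * A + 2) by rewrite mulr_ge0//; lra.
exists (L * (2 * rho + 3 * A + 2) + L * (L + 4 * A + 2) + 1), 0%N.
split=> [|r n hr _ x0]; first lra.
have r1 : 1 <= r by lra.
have es := expander_sym hexp (n := n); have ec := expander_conn hexp (n := n).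
pose wd : Zg R g -> Zg R g -> R := warped_cone T (@Zdist R g) act n.
have wdxx z : wd z z = 0.
  by apply: warped_dist_refl => //; exact: Zdist_ge0.
have wdC z w : wd z w = wd w z by exact: warped_dist_sym.
have wdt x y z : wd x z <= wd x y + wd y z by exact: warped_dist_triangle.
have triv' (K : groupType) (b : Zg R g -> Zg R g -> K) :
    cocycle wd rho b -> coboundary wd (L + A) b.
  move=> bc; have [adm|nadm] := pselect (exists m, warped_admissible T (@Zdist R g) act n.+1%:R m).
    exact: triv.
  (* Without admissible metrics the supremum is 0, and so is the distance. *)
  have wd0 z w : wd z w = 0 by exact: warped_dist_noadm.
  exists (b (f n x0)) => z w _.
  by rewrite -(bc (f n x0) z w) ?wd0// mulKg.
have [h hh] := coarsely_dense (fun y => (hf n).2 y).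
apply: pi1r_vanishes_coboundary.
- lra.
- exact: graph_dist_refl.
- exact: graph_dist_sym.
- exact: graph_dist_conn.
- move=> K c cc; apply: graph_coboundary => //.
  apply: (@quasi_isometry_coboundary R _ _ _ wd (f n) A _ _ _ wdC wdt A0 L rho r h) => //.
  + exact: graph_dist_refl.
  + exact: graph_dist_sym.
  + exact: graph_dist_triangle.
  + exact: (hf n).1.
  + exact: triv'.
Qed.

(** * Warped cones of free actions *)

Section CompactMetric.
Variables (R : realType) (Y : metricType R).
Hypothesis Ycpt : compact [set: Y].
Local Notation d := (@mdist R Y).

Lemma nbhs_mdist_ball (y : Y) e : 0 < e -> nbhs y [set z | d y z < e].
Proof. by move=> e0; rewrite -ballEmdist; exact: nbhsx_ballx. Qed.

(** Compactness as a near-covering property: a positive constant that works locally, and may be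
    decreased, can be chosen globally. *)
Lemma compact_uniform (P : Y -> R -> Prop) :
  (forall y e e', e' <= e -> P y e -> P y e') ->
  (forall y0, exists2 e, 0 < e & forall y, d y0 y < e -> P y e) ->
  exists2 e, 0 < e & forall y, P y e.
Proof.
move=> mono loc; have /compact_near_coveringP cpt := Ycpt.
have h y0 : [set: Y] y0 -> \forall y \near y0 & e \near (0 : R)^'+, P y e.
  move=> _; have [e e0 he] := loc y0.
  exists ([set y | d y0 y < e], [set e' | e' <= e]) => /=.
    by split; [exact: nbhs_mdist_ball|exact: nbhs_right_le].
  by move=> [y e'] /= [/he h1 h2]; exact: mono h1.
have [e [e0 he]] := filter_ex (filterI (nbhs_right_gt 0) (cpt _ _ (fun e y => P y e) _ h)).
by exists e => // y; exact: he.
Qed.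

Lemma continuous_mdist (f : Y -> Y) : continuous f ->
  forall y e, 0 < e -> exists2 a, 0 < a & forall z, d y z < a -> d (f y) (f z) < e.
Proof.
move=> fc y e e0; have : nbhs y (f @^-1` [set z | d (f y) z < e]).
  by apply: fc; exact: nbhs_mdist_ball.
by move=> /nbhs_ballP[a a0 ha]; exists a => // z yz; apply: ha; rewrite ballEmdist.
Qed.

Lemma compact_uniformly_continuous (f : Y -> Y) : continuous f ->
  forall e, 0 < e -> exists2 a, 0 < a & forall y z, d y z <= a -> d (f y) (f z) <= e.
Proof.
move=> fc e e0; apply: compact_uniform => [y a a' aa h z yz|y].
  by apply: h; exact: le_trans aa.
have [|a a0 ha] := continuous_mdist fc y (e := e / 2); first by rewrite divr_gt0.
exists (a / 2); first by rewrite divr_gt0.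
move=> z yz w zw; have := metric_triangle (f z) (f y) (f w).
have yz1 : d y z < a by apply: lt_trans yz _; lra.
have yw1 : d y w < a.
  by apply: le_lt_trans (metric_triangle y z w) _; lra.
rewrite (metric_sym (f z) (f y)); have := ha _ yz1; have := ha _ yw1; lra.
Qed.

Lemma compact_displacement (f : Y -> Y) : continuous f -> (forall y, f y <> y) ->
  exists2 a, 0 < a & forall y, a <= d y (f y).
Proof.
move=> fc nfix; apply: compact_uniform => [y a a' aa h|y]; first exact: le_trans h.
pose b := d y (f y).
have b0 : 0 < b by rewrite mdist_gt0; apply/eqP => /esym; exact: nfix.
have [|a a0 ha] := continuous_mdist fc y (e := b / 3); first by rewrite divr_gt0.
exists (Num.min a (b / 3)); first by rewrite lt_min a0 divr_gt0.
move=> z; rewrite lt_min => /andP[h1 h2].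
have h3 := ha _ h1.
have h4 := metric_triangle y z (f y).
have h5 := metric_triangle z (f z) (f y); rewrite (metric_sym (f z) (f y)) in h5.
by rewrite ge_min; apply/orP; right; rewrite /b in b0 h2 h3 *; lra.
Qed.

(** A potential that is constant on short steps, at whatever small scale, takes equal values at such
    [y] and [z]. *)
Definition chain_conn (y z : Y) : Prop := forall e, 0 < e ->
  exists l, path (fun u v => d u v <= e) y l /\ last y l = z.

Lemma chain_conn_sym y z : chain_conn y z -> chain_conn z y.
Proof.
move=> yz e /yz[l [p <-]].
by exists (rev (belast y l)); apply: rev_pathP p => // *; exact: metric_sym.
Qed.

Lemma chain_conn_trans x y z : chain_conn x y -> chain_conn y z -> chain_conn x z.
Proof.
move=> xy yz e e0; have [l [p q]] := xy e e0; have [l' [p' q']] := yz e e0.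
by exists (l ++ l'); rewrite cat_path last_cat p q.
Qed.

(** The points reached from [y] by chains of step [e] form a set that is open and closed. *)
Lemma connected_chain_conn (C : set Y) y z : connected C -> C y -> C z -> chain_conn y z.
Proof.
move=> Cc Cy Cz e e0.
pose A : set Y := [set w | exists l, path (fun u v => d u v <= e) y l /\ last y l = w].
have Astep u v : A u -> d u v <= e -> A v.
  by move=> [l [p q]] uv; exists (rcons l v); rewrite rcons_path last_rcons p q.
have Ao : open A.
  rewrite openE => u Au; apply/nbhs_ballP; exists e => // v; rewrite ballEmdist /= => uv.
  by apply: Astep Au _; exact: ltW.
have Acl : closed A.
  rewrite -openC openE => u Au; apply/nbhs_ballP; exists e => // v; rewrite ballEmdist /= => uv Av.
  by apply: Au; apply: Astep Av _; rewrite metric_sym ltW.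
have e1 : C `&` A = C.
  apply: Cc; [|by exists A|by exists A].
  by exists y; split=> //; exists [::].
by have : (C `&` A) z by [rewrite e1]; case.
Qed.

Hypothesis Yman : is_manifold R Y.

(* A chart maps a straight segment to a connected set. *)
Lemma manifold_chain_conn p : nbhs p [set q | chain_conn p q].
Proof.
have [k /(_ p)[U [phi [psi [[Uo Up] phUo phc psc phK]]]]] := Yman.
have phUp : (phi @` U) (phi p) by exists p.
have /nbhs_ballP[e e0 he] : nbhs (phi p) (phi @` U) by exact: open_nbhs_nbhs.
have phicont : {in U, continuous phi} by rewrite -continuous_open_subspace.
have psicont : {in phi @` U, continuous psi} by rewrite -continuous_open_subspace.
have W1 : nbhs p (phi @^-1` ball (phi p) e).
  by apply: phicont; [rewrite inE|exact: nbhsx_ballx].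
have W2 : nbhs p U by exact: open_nbhs_nbhs.
apply: filterS (filterI W1 W2) => q [/= qe Uq].
pose ga (s : R) : 'rV[R]_k := phi p + s *: (phi q - phi p).
have gaball s : 0 <= s <= 1 -> ball (phi p) e (ga s).
  move=> /andP[s0 s1]; move: qe; rewrite -ball_normE /ga /= => h.
  apply: le_lt_trans h.
  by rewrite opprD addNKr normrN normrZ (ger0_norm s0) distrC ler_piMl.
have gac : continuous ga.
  move=> s; apply: cvgD; first exact: cvg_cst.
  by apply: cvgZr_tmp; exact: cvg_id.
have seg := @segment_connected R 0 1.
have cc : connected ((psi \o ga) @` `[0, 1]).
  apply: connected_continuous_connected seg _.
  apply: continuous_in_subspaceT => s; rewrite inE /= in_itv /= => hs.
  apply: continuous_comp; first exact: gac.
  by apply: psicont; rewrite inE; apply: he; exact: gaball.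
apply: (connected_chain_conn cc).
  exists 0; first by rewrite /= in_itv /= lexx ler01.
  by rewrite /= /ga scale0r addr0 phK.
exists 1; first by rewrite /= in_itv /= lexx ler01.
by rewrite /= /ga scale1r addrC subrK phK.
Qed.

(** By compactness an orbit sequence indexed by distinct group elements accumulates at some [p]; two
    of its terms are chain connected to [p], hence to each other. *)
Lemma infinite_orbit_chain_conn (H : groupType) (act : H -> Y -> Y) (y : Y) :
  infinite_set [set: H] -> group_action act ->
  exists h z, h <> 1%g /\ chain_conn z (act h z).
Proof.
move=> /infiniteP /card_leP[f0] [a1 aM].
pose f (n : nat) : H := val (f0 (to_setT n)).
have finj : injective f.
  by move=> m n /val_inj /inj; rewrite !inE => /(_ I I) /(congr1 val).
pose u n := act (f n) y.
have [p [_ clp]] : [set: Y] `&` cluster (u n @[n --> \oo]) !=set0.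
  by apply: Ycpt; exact: filterT.
have near_p n : exists2 m, (n < m)%N & chain_conn p (u m).
  have Hn : (u n @[n --> \oo]) (u @` [set m | (n < m)%N]).
    by exists n.+1 => // m /= nm; exists m.
  by have [_ [[m nm <-] h]] := clp _ _ Hn (manifold_chain_conn p); exists m.
have [m _ hm] := near_p 0%N; have [m' mm' hm'] := near_p m.
exists (f m' * (f m)^-1)%g, (u m); split.
  by move=> /divg1_eq /finj e; move: mm'; rewrite e ltnn.
rewrite /u -aM mulgVK; apply: chain_conn_trans hm'; exact: chain_conn_sym.
Qed.

End CompactMetric.

Lemma finite_word_ball (G : groupType) (S : set G) k :
  finite_set S -> symmetric_set S -> finite_set (word_ball S k).
Proof.
move=> Sfin Ssym; elim: k => [|k ih].
  apply: (@sub_finite_set _ _ [set 1%g]); last exact: finite_set1.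
  by move=> _ [[|s l] [l0 _ ->]] //=; rewrite big_nil.
apply: (@sub_finite_set _ _ ([set 1%g] `|`
    ((fun sw => sw.1 * sw.2)%g @` (S `*` word_ball S k)))); last first.
  rewrite finite_setU; split; first exact: finite_set1.
  by apply: finite_image; exact: finite_setX.
move=> _ [[|s l] [lk lS ->]]; first by left; rewrite /= big_nil.
right; exists (s, \prod_(u <- l) u)%g; last by rewrite big_cons.
split=> /=.
  have := lS s; rewrite inE eqxx => /(_ isT)[//|/Ssym]; by rewrite invgK.
by exists l; split=> // u ul; apply: lS; rewrite inE ul orbT.
Qed.

(** Reduces to [finite_uniform] by passing to reciprocals. *)
Lemma finite_uniform_pos (R : realFieldType) (T : Type) (A : set T) (P : T -> R -> Prop) :
  finite_set A -> (forall x e e', e' <= e -> P x e -> P x e') ->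
  (forall x, exists2 e, 0 < e & P x e) -> exists2 e, 0 < e & forall x, A x -> P x e.
Proof.
move=> Afin mono loc.
have [||M hM] := @finite_uniform R T A (fun x M => forall e, 0 < e -> e * M <= 1 -> P x e) Afin.
- move=> x M M' MM h e e0 he; apply: h => //; apply: le_trans he.
  by rewrite ler_pM2l.
- move=> x; have [e e0 he] := loc x; exists e^-1 => e' e'0.
  by rewrite ler_pdivrMr// mul1r => /mono; exact.
have N0 : 0 < Num.max M 1 by rewrite lt_max ltr01 orbT.
exists (Num.max M 1)^-1; first by rewrite invr_gt0.
move=> x Ax; apply: hM => //; first by rewrite invr_gt0.
by rewrite mulrC ler_pdivrMr// mul1r le_max lexx.
Qed.

Section FreeWarpedCone.
Variables (R : realType) (Y : metricType R) (H : groupType) (S : set H).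
Variable act : H -> Y -> Y.
Hypothesis Ycpt : compact [set: Y].
Hypothesis Sfin : finite_set S.
Hypothesis Ssym : symmetric_set S.
Hypothesis act_act : group_action act.
Hypothesis act_cont : forall h, continuous (act h).
Hypothesis act_free : free_action act.
Local Notation d := (@mdist R Y).
Local Notation wd n := (warped_cone S d act n).
Local Notation wchain := (wchain S d act).
Local Open Scope group_scope.

(** The truncated metric shows that the supremum defining the warped distance is over a nonempty
    set. *)
Lemma admissible_min (t : R) : (0 < t)%R ->
  warped_admissible S d act t (fun y z => Num.min (t * d y z) 1)%R.
Proof.
move=> t0; have td0 y z : (0 <= t * d y z)%R by rewrite mulr_ge0 ?mdist_ge0 ?ltW.
split.
- split.
  + by move=> x y; rewrite le_min td0 ler01.
  + move=> x y; split=> [|->]; last by rewrite mdistxx mulr0 min_l ?ler01.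
    case: (leP (t * d x y)%R 1%R) => [_ /eqP|_ /eqP]; last by rewrite oner_eq0.
    by rewrite mulf_eq0 gt_eqF//= => /eqP /mdist_positivity.
  + by move=> x y; rewrite metric_sym.
  + move=> x y z; have tri := metric_triangle x y z.
    have {}tri : (t * d x z <= t * d x y + t * d y z)%R by rewrite -mulrDr ler_pM2l.
    have := td0 x y; have := td0 y z.
    by case: (leP (t * d x z)%R 1%R); case: (leP (t * d x y)%R 1%R);
      case: (leP (t * d y z)%R 1%R); lra.
- by move=> x y; rewrite ge_min lexx.
- by move=> s y _; rewrite ge_min lexx orbT.
Qed.

(** The moves after the last jump are merged by the triangle inequality, which prepares an induction
    on the number of jumps. *)
Lemma wchain_last_jump x y k l : wchain x y k l ->
  (k = 0%N /\ (d y x <= l)%R) \/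
  exists m z s l1, [/\ k = m.+1, S s, wchain x z m l1, (l1 <= l)%R &
    (d y (act s z) <= l - l1)%R].
Proof.
elim=> [|{}y z {}k {}l _ ih|s {}y {}k {}l Ss ch _].
- by left; rewrite mdistxx.
- have tri p := metric_triangle z y p; rewrite (metric_sym z y) in tri.
  have yz0 : (0 <= d y z)%R by exact: mdist_ge0.
  case: ih => [[-> h]|[m [p [s [l1 [h1 h2 h3 h4 h5]]]]]].
    by left; split=> //; have := tri x; lra.
  right; exists m, p, s, l1; split=> //; first lra.
  by have := tri (act s p); lra.
- by right; exists k, y, s, l; split=> //; rewrite ?mdistxx ?subrr.
Qed.

(** If the moves are tiny, the end of a chain is near [h x], where [h] is the product of its jumps:
    generators are uniformly continuous and there are at most [k] jumps. *)
Lemma wchain_shadow k e : (0 < e)%R -> exists2 a, (0 < a)%R &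
  forall x y m l, wchain x y m l -> (m <= k)%N -> (l <= a)%R ->
  exists h, word_ball S k h /\ (d y (act h x) <= e)%R.
Proof.
elim: k e => [|k ih] e e0.
  exists e => // x y m l /wchain_last_jump[[-> h] _ le|[m' [z [s [l1 [-> _ _ _ _]]]]] //].
  exists 1; split; first exact: word_ball1.
  by rewrite act_act.1; exact: le_trans le.
have e20 : (0 < e / 2)%R by rewrite divr_gt0.
have [||b b0 hb] := @finite_uniform_pos R H S
  (fun s b => forall u v, (d u v <= b -> d (act s u) (act s v) <= e / 2)%R) Sfin.
- by move=> s b b' bb h u v uv; apply: h; exact: le_trans bb.
- move=> s; exact: compact_uniformly_continuous.
have [a1 a10 h1] := ih b b0.
exists (Num.min a1 (e / 2))%R; first by rewrite lt_min a10.
move=> x y m l ch; rewrite le_min => mk /andP[la1 la2].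
case: (wchain_last_jump ch) => [[m0 h]|[m' [z [s [l1 [m1 Ss ch1 l1l yz]]]]]].
  exists 1; split; first exact: word_ball1.
  by rewrite act_act.1; lra.
have [|//|h [hk zh]] := h1 _ _ _ _ ch1; first by rewrite m1 in mk.
  exact: le_trans la1.
exists (s * h); split.
  by rewrite -add1n; apply: word_ballM => //; apply: word_ball_gen; left.
rewrite act_act.2; have := hb s Ss _ _ zh.
have := metric_triangle y (act s z) (act s (act h x)).
have := wchain_ge0 (@mdist_ge0 R Y) ch1; lra.
Qed.

Lemma free_displacement k : exists2 a, (0 < a)%R &
  forall h y, word_ball S k h -> (d y (act h y) < a)%R -> h = 1.
Proof.
have [||a a0 ha] := @finite_uniform_pos R H (word_ball S k)
  (fun h a => forall y, (d y (act h y) < a)%R -> h = 1) (finite_word_ball k Sfin Ssym).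
- by move=> h e e' ee hh y yh; apply: (hh y); exact: lt_le_trans ee.
- move=> h; have [->|/eqP h1] := eqVneq h 1; first by exists 1%R.
  have [|a a0 ha] := compact_displacement Ycpt (@act_cont h).
    by move=> y /act_free.
  by exists a => // y; rewrite ltNge ha.
by exists a => // h y hk; exact: ha.
Qed.

(** The inverse puts products in the order of the cocycle relation: [y] near [g^-1 x] and [z] near
    [g'^-1 y] give [z] near [(g g')^-1 x]. *)
Definition shadow k e (x y : Y) : set H :=
  [set h | word_ball S (k + k) h /\ (d y (act h^-1 x) <= e)%R].

Lemma free_warped_cocycle (rho : R) : (0 <= rho)%R ->
  exists (e : R) (n0 : nat), (0 < e)%R /\ forall n, (n0 <= n)%N ->
    exists c : Y -> Y -> H, [/\ cocycle (wd n) rho c,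
      forall s z, S s -> c z (act s z) = s^-1 &
      forall z w, (d z w <= e)%R -> c z w = 1].
Proof.
move=> rho0; pose k := (Num.truncn (rho + 1)).+1.
have rk : (rho + 1 < k%:R)%R by exact: truncnS_gt.
have [a a0 ha] := free_displacement (k + k + (k + k)).
(* Two shadows of one pair move a point by at most [2 e < a], so they coincide. *)
pose e := (a / 3)%R; have e0 : (0 < e)%R by rewrite divr_gt0.
have [||b b0 hb] := @finite_uniform_pos R H (word_ball S k)
  (fun s b => forall u v, (d u v <= b -> d (act s u) (act s v) <= e / 2)%R)
  (finite_word_ball k Sfin Ssym).
- by move=> s b b' bb h u v uv; apply: h; exact: le_trans bb.
- move=> s; apply: compact_uniformly_continuous => //; by rewrite divr_gt0.
(* Composing two lifts with error [e1] costs at most [e / 2] for the first one, after a word of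
   length [k] acts, and [e / 2] for the second. *)
pose e1 := Num.min b (e / 2)%R.
have e10 : (0 < e1)%R by rewrite lt_min b0 divr_gt0.
have [dl dl0 hdl] := wchain_shadow k e10.
(* From this level on, a chain of cost below [k] moves by at most [k / t <= dl] inside [Y]. *)
exists e, (Num.truncn (k%:R / dl)).+1; split=> // n hn.
set t : R := n.+1%:R%R.
have t0 : (0 < t)%R by rewrite ltr0n.
have ktl : (k%:R / t <= dl)%R.
  rewrite ler_pdivrMr// mulrC -ler_pdivrMr//; apply/ltW/(lt_trans (truncnS_gt _)).
  by rewrite ltr_nat ltnS.
have uniq x y g g' : shadow k e x y g -> shadow k e x y g' -> g = g'.
  move=> [gk gd] [gk' gd'].
  have w : word_ball S (k + k + (k + k)) (g'^-1 * g).
    by apply: word_ballM => //; exact: word_ballV.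
  have : g'^-1 * g = 1.
    apply: (ha _ (act g^-1 x) w); rewrite -act_act.2 mulgK.
    have := metric_triangle (act g^-1 x) y (act g'^-1 x).
    rewrite (metric_sym _ y) /e in gd gd' *; lra.
  by move=> e2; rewrite -[g'](mulg1) -e2 mulKVg.
pose c x y := xget 1 (shadow k e x y).
have cE x y g : shadow k e x y g -> c x y = g.
  move=> hg; have hc : shadow k e x y (c x y) by apply: xgetPex; exists g.
  exact: uniq hc hg.
have short x y : (wd n x y <= rho)%R -> exists g, word_ball S k g /\ (d y (act g^-1 x) <= e1)%R.
  move=> xy.
  have [m [l [ch lt]]] : exists m l, wchain x y m l /\ (m%:R + t * l < rho + 1)%R.
    apply: warped_dist_chain => //.
    + exact: mdist_ge0.
    + exact: metric_sym.
    + by eexists; exact: admissible_min.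
    + by apply: le_lt_trans xy _; rewrite ltrDl.
  have l0 := wchain_ge0 (@mdist_ge0 R Y) ch.
  have tl0 : (0 <= t * l)%R by rewrite mulr_ge0// ltW.
  have mk : (m <= k)%N by rewrite -(ler_nat R); lra.
  have m0 : (0 <= m%:R :> R)%R by [].
  have lk : (l <= dl)%R.
    by apply: le_trans ktl; rewrite ler_pdivlMr// mulrC; lra.
  have [h [hk hd]] := hdl _ _ _ _ ch mk lk.
  by exists h^-1; rewrite invgK; split=> //; exact: word_ballV.
have e1e : (e1 <= e / 2)%R by rewrite ge_min lexx orbT.
have short_shadow x y g : word_ball S k g -> (d y (act g^-1 x) <= e1)%R -> shadow k e x y g.
  by move=> gk gd; split; [apply: word_ball_le gk; exact: leq_addr|lra].
exists c; split.
- move=> x y z /short[g [gk gd]] /short[g' [gk' gd']].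
  rewrite (cE _ _ _ (short_shadow _ _ _ gk gd)) (cE _ _ _ (short_shadow _ _ _ gk' gd')).
  apply/esym/cE; split; first exact: word_ballM.
  rewrite invgM act_act.2.
  have gdb : (d y (act g^-1 x) <= b)%R by apply: le_trans gd _; rewrite ge_min lexx.
  have := hb _ (word_ballV gk') _ _ gdb.
  have := metric_triangle z (act g'^-1 y) (act g'^-1 (act g^-1 x)); lra.
- move=> s z Ss; apply: cE; split; last by rewrite invgK mdistxx ltW.
  by apply: (@word_ball_le _ _ 1) => //; apply: word_ball_gen; left; exact: Ssym.
- move=> z w zw; apply: cE; split; first exact: word_ball1.
  by rewrite invg1 act_act.1 metric_sym.
Qed.

(** Along a word for [h] the primitive changes by [h^-1], whereas along a fine chain from [z] to
    [h z] it does not change. *)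
Lemma free_warped_coboundary n e (c : Y -> Y -> H) h z : (0 < e)%R ->
  generates S -> 
  (forall s z, S s -> c z (act s z) = s^-1) ->
  (forall z w, (d z w <= e)%R -> c z w = 1) ->
  coboundary (wd n) 1 c -> chain_conn z (act h z) -> h = 1.
Proof.
move=> e0 genS cj cs [phi hphi] zh.
have t0 : (0 < n.+1%:R :> R)%R by rewrite ltr0n.
have wle x y m l : wchain x y m l -> (wd n x y <= m%:R + n.+1%:R * l)%R.
  by apply: warped_dist_chain_le; [exact: mdist_ge0|exact: ltW].
have walk k w : word_ball S k w -> forall x, (phi x)^-1 * phi (act w x) = w^-1.
  move=> [l [_ hl ->]] x; elim: l hl => [|s l ih] hl.
    by rewrite big_nil act_act.1 mulVg invg1.
  have Ss : S s.
    have := hl s; rewrite inE eqxx => /(_ isT)[//|/Ssym]; by rewrite invgK.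
  rewrite big_cons act_act.2 invgM.
  set v := act (\prod_(j <- l) j) x.
  have -> : (\prod_(j <- l) j)^-1 = (phi x)^-1 * phi v.
    by rewrite ih// => u ul; apply: hl; rewrite inE ul orbT.
  rewrite -(cj s v Ss) hphi; first by rewrite -mulgA mulKVg.
  by apply: le_trans (wle _ _ _ _ (wchain_jump1 _ _ _ Ss)) _; rewrite mulr0 addr0.
have [k hk] := genS h.
have := walk k h hk z.
(* Steps of length at most [1 / t] have warped distance at most 1, the scale of the coboundary. *)
pose e' := Num.min e (n.+1%:R^-1)%R.
have e'0 : (0 < e')%R by rewrite lt_min e0 invr_gt0.
have [l [p <-]] := zh e' e'0.
have -> : phi (last z l) = phi z.
  elim: l z p {zh} => //= y l ih z /andP[zy p]; rewrite ih//.
  have : c z y = 1 by apply: cs; apply: le_trans zy _; rewrite ge_min lexx.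
  rewrite hphi; first by move=> /mulg1_eq; rewrite invgK.
  apply: le_trans (wle _ _ _ _ (wchain_move1 _ _ _ z y)) _.
  rewrite add0r -ler_pdivlMl// mulr1; apply: le_trans zy _.
  by rewrite ge_min lexx orbT.
by rewrite mulVg => /esym/eqP; rewrite invg_eq1 => /eqP.
Qed.

End FreeWarpedCone.

(** At a large level the shadow cocycle is a coboundary, so no nontrivial [h] can carry a point to
    one chain connected to it; an infinite group acting on a compact manifold has such an [h]. *)
Lemma not_coarsely_equivalent_free_warped_cone (R : realType) (V : nat -> finType)
    (e : forall n, rel (V n)) (H : groupType) (S : set H) (Y : metricType R)
    (act : H -> Y -> Y) :
  expander R e ->
  (exists (r0 : R) (n0 : nat), 0 < r0 /\
     forall (r : R) (n : nat), r0 <= r -> (n0 <= n)%N ->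
     forall x : V n, pi1r_vanishes (graph_dist R (@e n)) r x) ->
  finite_set S -> symmetric_set S -> generates S ->
  infinite_set [set: H] ->
  compact [set: Y] -> is_manifold R Y ->
  group_action act -> (forall h : H, continuous (act h)) ->
  free_action act ->
  ~ coarsely_equivalent (fun n => graph_dist R (@e n))
      (warped_cone S (fun y y' : Y => mdist y y') act).
Proof.
move=> hexp van Sfin Ssym Sgen Hinf Ycpt Yman act_act act_cont act_free coarse.
have m0 : forall x y : Y, 0 <= mdist x y by exact: mdist_ge0.
have t0 n : 0 <= n.+1%:R :> R by [].
have [rho [n0 triv]] := coarsely_equivalent_coboundary hexp
  (fun n => warped_dist_refl S act m0 (t0 n))
  (fun n => warped_dist_sym S (@mdist R Y) act n.+1%:R)
  (fun n => warped_dist_triangle S (@mdist R Y) act n.+1%:R) van coarse.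
have rho'0 : 0 <= Num.max rho 0 by rewrite le_max lexx orbT.
have [a [n1 [a0 hc]]] := free_warped_cocycle Ycpt Sfin Ssym act_act act_cont act_free rho'0.
pose n := maxn n0 n1.
have [[y] triv'] := triv n (leq_maxl _ _).
have [c [cc cj cs]] := hc n (leq_maxr _ _).
have [h [z [h1 zh]]] := infinite_orbit_chain_conn Ycpt Yman y Hinf act_act.
apply: h1; apply: (free_warped_coboundary Ssym act_act a0 Sgen cj cs _ zh).
apply: triv' => u v w uv vw; apply: cc.
  by apply: le_trans uv _; rewrite le_max lexx.
by apply: le_trans vw _; rewrite le_max lexx.
Qed.

Theorem theorem6 (R : realType) (g : nat) (hg : (1 < g)%N)
  (act : F2 -> Zg R g -> Zg R g) (hact : multitwist_action act)
  (T : set F2) (hTfin : finite_set T) (hTsym : symmetric_set T)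
  (hTgen : generates T)
  (V : nat -> finType) (e : forall n : nat, rel (V n))
  (hexp : expander R e)
  (hqi : quasi_isometric (fun n : nat => graph_dist R (e n))
           (warped_cone T (@Zdist R g) act)) :
  (exists (r0 : R) (n0 : nat), 0 < r0 /\
     forall (r : R) (n : nat), r0 <= r -> (n0 <= n)%N ->
     forall x : V n, pi1r_vanishes (graph_dist R (e n)) r x)
  /\
  (forall (G : groupType) (S : set G) (N : nat -> set G),
     finite_set S -> generates S -> box_filtration S N ->
     ~ coarsely_equivalent (fun n : nat => graph_dist R (e n))
         (fun n : nat => graph_dist R (@cayley_quotient G S (N n))))
  /\
  (forall (H : groupType) (S : set H) (Y : metricType R)
     (actY : H -> Y -> Y),
     finite_set S -> symmetric_set S -> generates S ->
     infinite_set [set: H] ->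
     compact [set: Y] -> is_manifold R Y ->
     group_action actY -> (forall h : H, continuous (actY h)) ->
     free_action actY ->
     ~ coarsely_equivalent (fun n : nat => graph_dist R (e n))
         (warped_cone S (fun y y' : Y => mdist y y') actY)).
Proof.
have van := staircase_expander_vanishes hg hact hTfin hTsym hTgen hexp hqi.
split; first exact: van.
split=> [G S N _ genS box|H S Y actY].
  exact: not_coarsely_equivalent_box_space.
exact: not_coarsely_equivalent_free_warped_cone.
Qed.
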